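(* Let $x_{1:K}=(x_1,\dots,x_K)$ and $\hat x_{1:K}=(\hat x_1,\dots,\hat x_K)$ denote the iterates of LMC and SGLD respectively, run with the same step size $\eta>0$ and the same initial distribution, SGLD having batch size $B\ge1$. Suppose the almost-sure linear growth condition holds with constants $M,G\ge0$ and the SGLD iterates satisfy the $p$-moment growth condition with $p=6$ and constants $C_q$. Then, up to a universal multiplicative constant, $$\mathsf{KL}(\mathrm{Law}(\hat x_{1:K})\|\mathrm{Law}(x_{1:K}))\lesssim\frac{\eta^2K}{B^2}\left(M^4C_4d^2+G^4\right)+\frac{\eta^3K}{B^4}\left(M^6C_6d^6+G^6d^3\right)(1+\log B)^2.$$
   Context: Setting. $F:\mathbb R^d\to\mathbb R$ is differentiable. $\xi$ is a random variable with law $\mathbb P_\xi$ on a space $\Xi$, and $f(x,\xi)$ satisfies $\mathbb E_\xi[\nabla f(x,\xi)]=\nabla F(x)$ for all $x$. LMC with step size $\eta$: $x_{k+1}=x_k-\eta\nabla F(x_k)+\sqrt{2\eta}\,\epsilon_k$, $\epsilon_k\sim\mathcal N(0,I)$ i.i.d., independent of $x_0$. SGLD with step size $\eta$ and batch size $B\in\mathbb N$: $\hat x_{k+1}=\hat x_k-\frac{\eta}{B}\sum_{i=1}^B\nabla f(\hat x_k,\xi_{k,i})+\sqrt{2\eta}\,\epsilon_k$, where $\epsilon_k\sim\mathcal N(0,I)$ i.i.d., $\xi_{k,i}\sim\mathbb P_\xi$ i.i.d., all independent of each other and of $\hat x_0$. Almost-sure linear growth condition: $\|\nabla f(x,\xi)-\nabla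 F(x)\|\le M\|x\|+G$ for all $x\in\mathbb R^d$, $\xi\in\Xi$. $p$-moment growth: $\mathbb E\|\hat x_k\|^q\le C_q d^{q/2}$ for all $q\in[0,p]$ and $k=0,1,\dots,K$, where $C_q\ge0$ is a non-negative increasing function of $q$. *)

(* Defs.v *)
From HB Require Import structures.
From mathcomp Require Import all_boot all_order all_algebra.
From mathcomp Require Import all_classical all_reals all_analysis.
Import Order.TTheory GRing.Theory Num.Theory.
Import numFieldNormedType.Exports.

Set Implicit Arguments.
Unset Strict Implicit.
Unset Printing Implicit Defensive.

Local Open Scope classical_set_scope.
Local Open Scope ring_scope.

(* The library has no measurable structure on row vectors. We take the product
   sigma-algebra, generated by the coordinates, i.e. the Borel one on R^d. *)

Definition measure_rV_display : measure_display -> measure_display.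
Proof. exact. Qed.

Section measurable_rV.
Context {R : realType} {d : nat}.

Let coors : 'I_d -> 'rV[R]_d -> R := fun i x => x ord0 i.

Let rV_set0 : g_sigma_preimage coors set0.
Proof. exact: sigma_algebra0. Qed.

Let rV_setC A : g_sigma_preimage coors A -> g_sigma_preimage coors (~` A).
Proof. exact: sigma_algebraC. Qed.

Let rV_bigcup (A : _^nat) : (forall i, g_sigma_preimage coors (A i)) ->
  g_sigma_preimage coors (\bigcup_i (A i)).
Proof. exact: sigma_algebra_bigcup. Qed.

HB.instance Definition _ :=
  @isMeasurable.Build (measure_rV_display default_measure_display)
    'rV[R]_d (g_sigma_preimage coors) rV_set0 rV_setC rV_bigcup.

End measurable_rV.

Definition enorm {R : realType} {d : nat} (x : 'rV[R]_d) : R :=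
  Num.sqrt (\sum_(i < d) x ord0 i ^+ 2).

Definition grad {R : realType} {d : nat} (F : 'rV[R]_d -> R) (x : 'rV[R]_d) :
  'rV[R]_d := \row_(i < d) 'D_(delta_mx ord0 i) F x.

Definition eq_law {R : realType} {disp} {T : measurableType disp}
    (mu nu : set T -> \bar R) : Prop :=
  forall A, measurable A -> mu A = nu A.

(* [N(0, I)] is the product law [N(0, 1)^d], which is determined by its values
   on measurable boxes. *)
Definition std_gaussian {R : realType} {disp} {Omega : measurableType disp}
    {P : probability Omega R} {d : nat} (X : {RV P >-> 'rV[R]_d}) : Prop :=
  forall A : 'I_d -> set R, (forall i, measurable (A i)) ->
    P [set w | forall i, A i (X w ord0 i)] =
    (\prod_(i < d) normal_prob 0 1 (A i))%E.

Definition sigma_RV {R : realType} {disp} {Omega : measurableType disp}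
    {P : probability Omega R} {disp'} {T : measurableType disp'}
    (X : {RV P >-> T}) : set_system Omega :=
  preimage_set_system [set: Omega] X measurable.

(* Independence is stated for families of sigma-algebras because the random
   variables involved take values in different spaces. *)
Definition mutually_independent {R : realType} {disp}
    {Omega : measurableType disp} (P : probability Omega R) {I : eqType}
    (E : I -> set_system Omega) : Prop :=
  forall (J : seq I) (A : I -> set Omega), uniq J ->
    (forall i, i \in J -> E i (A i)) ->
    P (\bigcap_(i in [set` J]) A i) = (\prod_(i <- J) P (A i))%E.

Definition LMC {R : realType} {d : nat} (F : 'rV[R]_d -> R) (eta : R)
    {disp} {Omega : measurableType disp} {P : probability Omega R}
    (x : nat -> {RV P >-> 'rV[R]_d}) : Prop :=
  exists eps : nat -> {RV P >-> 'rV[R]_d},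
  [/\ forall k, std_gaussian (eps k),
      mutually_independent P (fun s : option nat =>
        match s with
        | None => sigma_RV (x 0%N)
        | Some k => sigma_RV (eps k)
        end)
    & forall k w, x k.+1 w =
        x k w - eta *: grad F (x k w) + Num.sqrt (2 * eta) *: eps k w].

Definition SGLD {R : realType} {d : nat} {dispXi} {Xi : measurableType dispXi}
    (PXi : probability Xi R) (f : 'rV[R]_d -> Xi -> R) (eta : R) (B : nat)
    {disp} {Omega : measurableType disp} {P : probability Omega R}
    (x : nat -> {RV P >-> 'rV[R]_d}) : Prop :=
  exists (eps : nat -> {RV P >-> 'rV[R]_d})
         (xi : nat -> 'I_B -> {RV P >-> Xi}),
  [/\ forall k, std_gaussian (eps k),
      forall k i, eq_law (distribution P (xi k i)) PXi,
      mutually_independent P (fun s : option (nat + nat * 'I_B) =>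
        match s with
        | None => sigma_RV (x 0%N)
        | Some (inl k) => sigma_RV (eps k)
        | Some (inr (k, i)) => sigma_RV (xi k i)
        end)
    & forall k w, x k.+1 w =
        x k w - (eta / B%:R) *: (\sum_(i < B) grad (f ^~ (xi k i w)) (x k w))
        + Num.sqrt (2 * eta) *: eps k w].

(* Measurability of [grad f] in both arguments jointly is what makes the SGLD
   recursion define random variables. Integrability in the last clause is part
   of the equality, since the right-hand side is finite. *)
Definition unbiased_gradient {R : realType} {d : nat} {dispXi}
    {Xi : measurableType dispXi} (PXi : probability Xi R)
    (f : 'rV[R]_d -> Xi -> R) (F : 'rV[R]_d -> R) : Prop :=
  [/\ forall z x, differentiable (f ^~ z) x,
      measurable_fun [set: 'rV[R]_d * Xi] (fun u => grad (f ^~ u.2) u.1)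
    & forall x i, 'E_PXi[fun z => grad (f ^~ z) x ord0 i]%E
        = (grad F x ord0 i)%:E].

Definition linear_growth {R : realType} {d : nat} {Xi : Type}
    (f : 'rV[R]_d -> Xi -> R) (F : 'rV[R]_d -> R) (M G : R) : Prop :=
  forall x z, enorm (grad (f ^~ z) x - grad F x) <= M * enorm x + G.

Definition moment_growth {R : realType} {d : nat} {disp}
    {Omega : measurableType disp} {P : probability Omega R}
    (x : nat -> {RV P >-> 'rV[R]_d}) (K : nat) (p : R) (C : R -> R) : Prop :=
  [/\ forall q : R, 0 <= q <= p -> 0 <= C q,
      forall q r : R, 0 <= q -> q <= r -> r <= p -> C q <= C r
    & forall (q : R) k, 0 <= q <= p -> (k <= K)%N ->
        ('E_P[fun w => (enorm (x k w) `^ q)%R] <= (C q * d%:R `^ (q / 2))%:E)%E].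

(* The path [(x_1, ..., x_K)]; the initial point [x_0] is not included. *)
Section trajectory.
Context {R : realType} {disp disp'} {Omega : measurableType disp}
  {T : measurableType disp'} {P : probability Omega R}.
Variables (x : nat -> {RV P >-> T}) (K : nat).

Definition trajectory (w : Omega) : K.-tuple T := [tuple x i.+1 w | i < K].

Let measurable_trajectory : measurable_fun [set: Omega] trajectory.
Proof.
apply/measurable_fun_tnthP => i.
rewrite (_ : _ \o _ = x i.+1); first exact: measurable_funPT.
by apply/funext => w /=; rewrite tnth_mktuple.
Qed.

HB.instance Definition _ :=
  isMeasurableFun.Build _ _ _ _ trajectory measurable_trajectory.

End trajectory.

Definition KL {R : realType} {disp} {T : measurableType disp}
    (mu nu : probability T R) : \bar R :=
  if `[< mu `<< nu >] then
    (\int[mu]_t lne (Radon_Nikodym (charge_of_finite_measure mu) nu t))%E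
  else +oo%E.

(* Main.v *)
Require Import Defs.
From HB Require Import structures.
From mathcomp Require Import all_boot all_order all_algebra.
From mathcomp Require Import all_classical all_reals all_analysis.
From mathcomp Require Import measurable_realfun ring lra.
Import Order.TTheory GRing.Theory Num.Theory.
Import numFieldNormedType.Exports.

Set Implicit Arguments.
Unset Strict Implicit.
Unset Printing Implicit Defensive.

Local Open Scope classical_set_scope.
Local Open Scope ring_scope.

(** Let Z(x, z) = grad f(x, z) - grad F(x) and let V be the batch average of Z,
    scaled so that one SGLD step is one LMC step whose Gaussian eps is replaced by
    V + eps. Given x, the law of V + eps is a mixture of shifted Gaussians, with
    chi-square divergence E exp <V, V'> - 1 from N(0, I), where V' is an
    independent copy of V. As V is an average of B centered vectors of norm at
    most r = M |x| + G, it has dimension-free exponential moments, and this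
    divergence is O(a^2) with a = eta r^2 / (2 B), provided that a is at most a
    small constant. For larger a, the KL divergence of a step is at most
    E |V|^2 / 2 = O(a), and O(1 + a) is again O(a^2). Summing over the steps and using
    the fourth moment bound on the iterates gives the first term of the theorem,
    which dominates on its own.

    The laws of the paths are compared through a Gibbs variational bound: if W > 0
    satisfies E' [phi(X') W] <= E [phi(X)] for all phi >= 0, then
    KL(law X' || law X) <= E' [- ln W]. Here W is a product of inverse one-step
    likelihood ratios, which may depend on the hidden noise. *)

(** * Row vectors, inner products and integrals *)

(** Conditioning on the past is always Tonelli for a product of laws ([ge0_integral_indep]), never a
    conditional expectation. The exact density of one path law with respect to the other would
    average over the whole hidden noise; a product of one-step ratios that still see this noise only
    has to be integrated against functions of the current state, which goes through by induction on
    time. Such a weight is good enough because the density enters only through ln y <= y - 1,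
    applied to its product with the weight.

    Logarithms of both signs would raise integrability questions at each step. Each one is bounded
    by a non-negative cost minus 1, so that the integrals along the chain are of non-negative
    functions and the constants are subtracted once, at the end.

    The threshold 32 a^2 <= 1 is the range in which the exponential moment of s |S|^2, S the batch
    sum, is controlled for the s that the inner average over V' produces. The factor 320 covers both
    sides of it, so one bound 320 a^2 holds for every state and only the fourth moment of the
    iterates is left to insert. *)

Section measurable_row.
Context {R : realType} {n : nat}.

Lemma measurable_rVcoord (i : 'I_n) :
  measurable_fun [set: 'rV[R]_n] (fun v => v ord0 i).
Proof.
move=> _ Y mY; rewrite setTI; apply: sub_sigma_algebra => /=.
rewrite -bigcup_seq/=; exists i => /=; first by rewrite mem_index_enum.
by exists Y => //; rewrite setTI.
Qed.

(** The coordinates generate the sigma-algebra on row vectors, so its pullback by [f] is the one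
    generated by the coordinates of [f]. *)
Lemma measurable_fun_rVP d (T : measurableType d) (f : T -> 'rV[R]_n) :
  measurable_fun [set: T] f <->
  forall i, measurable_fun [set: T] (fun t => f t ord0 i).
Proof.
split=> [mf i|mf].
  exact: (measurableT_comp (measurable_rVcoord i) mf).
have -> : f = (fun t => f t) by [].
move=> _ A mA; rewrite setTI.
have : (g_sigma_preimage (fun i t => f t ord0 i)) (f @^-1` A).
  have -> : (fun i t => f t ord0 i) =
      (fun i => (fun v : 'rV[R]_n => v ord0 i) \o f) by [].
  rewrite g_sigma_preimage_comp; exists A => //; by rewrite setTI.
apply: smallest_sub; first exact: sigma_algebra_measurable.
rewrite -bigcup_seq/=; apply: bigcup_sub => i _ _ [B mB <-].
exact: mf.
Qed.

Context {d : measure_display} {T : measurableType d}.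
Implicit Types f g : T -> 'rV[R]_n.

Lemma measurable_rowD f g : measurable_fun [set: T] f ->
  measurable_fun [set: T] g -> measurable_fun [set: T] (fun t => f t + g t).
Proof.
move=> /measurable_fun_rVP mf /measurable_fun_rVP mg.
apply/measurable_fun_rVP => i; under eq_fun do rewrite mxE.
exact: measurable_funD.
Qed.

Lemma measurable_rowN f : measurable_fun [set: T] f ->
  measurable_fun [set: T] (fun t => - f t).
Proof.
move=> /measurable_fun_rVP mf.
apply/measurable_fun_rVP => i; under eq_fun do rewrite mxE.
exact: measurableT_comp.
Qed.

Lemma measurable_rowZ (k : T -> R) f : measurable_fun [set: T] k ->
  measurable_fun [set: T] f -> measurable_fun [set: T] (fun t => k t *: f t).
Proof.
move=> mk /measurable_fun_rVP mf.
apply/measurable_fun_rVP => i; under eq_fun do rewrite mxE.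
exact: measurable_funM.
Qed.

Lemma measurable_row_sum (I : Type) (r : seq I) (P : pred I)
    (F : I -> T -> 'rV[R]_n) :
  (forall i, measurable_fun [set: T] (F i)) ->
  measurable_fun [set: T] (fun t => \sum_(i <- r | P i) F i t).
Proof.
move=> mF; elim: r => [|i r IH].
  by under eq_fun do rewrite big_nil; exact: measurable_cst.
under eq_fun do rewrite big_cons.
by case: (P i) => //; exact: measurable_rowD.
Qed.

End measurable_row.

(** * Euclidean inner product and norm *)

Definition dotv {R : realType} {n : nat} (u v : 'rV[R]_n) : R :=
  \sum_(i < n) u ord0 i * v ord0 i.

Section dotv_theory.
Context {R : realType} {n : nat}.
Implicit Types u v w : 'rV[R]_n.

Lemma dotvC u v : dotv u v = dotv v u.
Proof. by apply: eq_bigr => i _; rewrite mulrC. Qed.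

Lemma dotvDl u v w : dotv (u + v) w = dotv u w + dotv v w.
Proof. by rewrite -big_split; apply: eq_bigr => i _; rewrite mxE mulrDl. Qed.

Lemma dotvDr u v w : dotv w (u + v) = dotv w u + dotv w v.
Proof. by rewrite dotvC dotvDl !(dotvC w). Qed.

Lemma dotvZl k u v : dotv (k *: u) v = k * dotv u v.
Proof. by rewrite /dotv mulr_sumr; apply: eq_bigr => i _; rewrite mxE mulrA. Qed.

Lemma dotvZr k u v : dotv v (k *: u) = k * dotv v u.
Proof. by rewrite dotvC dotvZl dotvC. Qed.

Lemma dot0v v : dotv 0 v = 0.
Proof. by rewrite -(scale0r 0) dotvZl mul0r. Qed.

Lemma dotv_ge0 v : 0 <= dotv v v.
Proof. by apply: sumr_ge0 => i _; rewrite -expr2 sqr_ge0. Qed.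

Lemma enorm_ge0 v : 0 <= enorm v. Proof. exact: sqrtr_ge0. Qed.

Lemma enorm_sqr v : enorm v ^+ 2 = dotv v v.
Proof.
rewrite /enorm sqr_sqrtr; first by apply: eq_bigr => i _; rewrite expr2.
by apply: sumr_ge0 => i _; rewrite sqr_ge0.
Qed.

Lemma dotv_eq0 v : dotv v v = 0 -> v = 0.
Proof.
move=> /eqP; rewrite psumr_eq0 => [|i _]; last by rewrite -expr2 sqr_ge0.
move=> /allP v0; apply/rowP => i; rewrite mxE.
have /implyP/(_ isT) := v0 i (mem_index_enum i).
by rewrite mulf_eq0 orbb => /eqP.
Qed.

Lemma dotv_sqr_le u v : dotv u v ^+ 2 <= dotv u u * dotv v v.
Proof.
have [v0|v0] := eqVneq (dotv v v) 0.
  by rewrite (dotv_eq0 v0) dotvC !dot0v expr0n mulr0.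
have vp : 0 < dotv v v by rewrite lt_def v0 dotv_ge0.
(* The squared norm of |v|^2 u - <u, v> v equals |v|^2 (|u|^2 |v|^2 - <u, v>^2). *)
have := dotv_ge0 (dotv v v *: u + (- dotv u v) *: v).
rewrite !(dotvDl, dotvDr, dotvZl, dotvZr) (dotvC v u).
set a := dotv u u; set b := dotv u v; set c := dotv v v => H.
have : 0 <= c * (a * c - b ^+ 2).
  by apply: le_trans H _; rewrite le_eqVlt; apply/orP; left; apply/eqP; ring.
by rewrite pmulr_rge0// subr_ge0.
Qed.

Lemma measurable_dotv d (T : measurableType d) (f g : T -> 'rV[R]_n) :
  measurable_fun [set: T] f -> measurable_fun [set: T] g ->
  measurable_fun [set: T] (fun t => dotv (f t) (g t)).
Proof.
move=> /measurable_fun_rVP mf /measurable_fun_rVP mg.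
by apply: measurable_sum => i; exact: measurable_funM.
Qed.

Lemma enormE v : enorm v = Num.sqrt (dotv v v).
Proof. by rewrite -enorm_sqr sqrtr_sqr ger0_norm// enorm_ge0. Qed.

Lemma measurable_sqrt : measurable_fun [set: R] (@Num.sqrt R).
Proof. exact: continuous_measurable_fun (@sqrt_continuous R). Qed.

Lemma measurable_enorm d (T : measurableType d) (f : T -> 'rV[R]_n) :
  measurable_fun [set: T] f -> measurable_fun [set: T] (fun t => enorm (f t)).
Proof.
move=> mf; under eq_fun do rewrite enormE.
by apply: (measurableT_comp measurable_sqrt); exact: measurable_dotv.
Qed.

End dotv_theory.

Lemma measurable_inv {R : realType} : measurable_fun [set: R] (@GRing.inv R).
Proof.
(* The square makes the base non-negative, so that its real power -1 is its inverse; at [x = 0] both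
   sides are 0. *)
have -> : @GRing.inv R = fun x => x * (x ^+ 2) `^ (- 1).
  apply/funext => x; rewrite powR_inv1 ?sqr_ge0// expr2 invfM.
  by have [->|x0] := eqVneq x 0; rewrite ?invr0 ?mulr0// mulVKf.
apply: measurable_funM => //.
by apply: (measurableT_comp (measurable_powR _)).
Qed.

(** * Measures given by a density *)

Section mdensity.
Local Open Scope ereal_scope.
Context d (T : measurableType d) (R : realType).
Variable mu : {measure set T -> \bar R}.
Variable g : T -> R.
Hypotheses (mg : measurable_fun [set: T] g) (g0 : forall t, (0 <= g t)%R).

(** The two proofs are arguments so that the measure structure declared below can be inferred from
    the term alone. *)
Definition mdensity (_ : measurable_fun [set: T] g) (_ : forall t, (0 <= g t)%R)
  (A : set T) : \bar R := \int[mu]_(t in A) (g t)%:E.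

Local Notation nu := (mdensity mg g0).

Let mdensity0 : nu set0 = 0. Proof. exact: integral_set0. Qed.

Let mdensity_ge0 A : 0 <= nu A.
Proof. by apply: integral_ge0 => t _; rewrite lee_fin. Qed.

Let mdensity_sigma_additive : semi_sigma_additive nu.
Proof.
move=> /= A mA tA mUA.
rewrite /mdensity ge0_integral_bigcup//=.
- apply: is_cvg_ereal_nneg_natsum_cond => n _ _.
  by apply: integral_ge0 => t _; rewrite lee_fin.
- by apply/measurable_funTS/measurable_EFinP.
- by move=> t _; rewrite lee_fin.
Qed.

HB.instance Definition _ := isMeasure.Build _ _ _ nu
  mdensity0 mdensity_ge0 mdensity_sigma_additive.

Import HBNNSimple.

(** For an indicator this is the definition of [mdensity]; linearity and monotone convergence extend
    it to non-negative functions. *)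
Lemma ge0_integral_mdensity (f : T -> \bar R) : (forall t, 0 <= f t) ->
  measurable_fun [set: T] f ->
  \int[nu]_t f t = \int[mu]_t (f t * (g t)%:E).
Proof.
move=> f0 mf; pose h := nnsfun_approx measurableT mf.
have -> : \int[nu]_t f t = lim (\int[nu]_t (EFin \o h n) t @[n --> \oo]).
  have fE t : f t = lim ((EFin \o h n) t @[n --> \oo]).
    by apply/esym/cvg_lim => //; exact: cvg_nnsfun_approx.
  under eq_integral => t _ do rewrite fE.
  apply: monotone_convergence => //.
  - by move=> n; apply/measurable_EFinP.
  - by move=> n t _ //=; rewrite lee_fin.
  - by move=> t _ a b ab; rewrite lee_fin; exact/lefP/nd_nnsfun_approx.
have -> : \int[mu]_t (f t * (g t)%:E) =
    lim (\int[mu]_t ((EFin \o h n) t * (g t)%:E) @[n --> \oo]).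
  have fE t : f t * (g t)%:E = lim ((EFin \o h n) t * (g t)%:E @[n --> \oo]).
    apply/esym/cvg_lim => //; apply: cvgeZr => //.
    exact: cvg_nnsfun_approx.
  under eq_integral => t _ do rewrite fE.
  apply: monotone_convergence => //.
  - move=> n; apply: emeasurable_funM; exact/measurable_EFinP.
  - by move=> n t _ /=; rewrite mule_ge0 ?lee_fin.
  - by move=> t _ a b ab/=; rewrite lee_wpmul2r ?lee_fin//; exact/lefP/nd_nnsfun_approx.
suff suf n : \int[nu]_t (EFin \o h n) t =
    \int[mu]_t ((EFin \o h n) t * (g t)%:E).
  by under eq_fun do rewrite suf.
have mI r : measurable_fun [set: T] (fun t => (r * \1_(h n @^-1` [set r]) t)%:E).
  by apply/measurable_EFinP; exact: measurable_funM.
transitivity (\int[nu]_t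
   (\sum_(y \in range (h n)) (y * \1_(h n @^-1` [set y]) t)%:E)).
  by apply: eq_integral => t _; rewrite /= fimfunE -fsumEFin.
rewrite ge0_integral_fsum//; last by move=> m y _; exact: nnfun_muleindic_ge0.
transitivity (\int[mu]_t (\sum_(y \in range (h n))
    (y * \1_(h n @^-1` [set y]) t)%:E * (g t)%:E)); last first.
  apply: eq_integral => t _.
  rewrite -ge0_mule_fsuml => [|y]; last exact: nnfun_muleindic_ge0.
  by rewrite fsumEFin // -(fimfunE _ t).
rewrite ge0_integral_fsum//; last 2 first.
- by move=> y; apply: emeasurable_funM => //; exact/measurable_EFinP.
- by move=> m y _; apply: mule_ge0; [exact: nnfun_muleindic_ge0|rewrite lee_fin].
apply: eq_fsbigr => r rhn.
under eq_integral do rewrite EFinM.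
rewrite integralZl_indic_nnsfun => //.
under [RHS]eq_integral do rewrite EFinM -muleA.
rewrite ge0_integralZl//.
- congr (_ * _); rewrite integral_indic// setIT /= /mdensity integral_mkcond.
  apply: eq_integral => t _.
  by rewrite patchE indicE; case: ifP => _; rewrite ?mul1e ?mul0e.
- by apply: emeasurable_funM; exact/measurable_EFinP.
- by move=> t _; rewrite mule_ge0 ?lee_fin.
- by move: rhn; rewrite inE => -[t _ <-]; rewrite lee_fin.
Qed.

End mdensity.

Lemma integral_probability_cst {R : realType} {d} {T : measurableType d}
    (P : probability T R) (c : \bar R) : (\int[P]_t c = c)%E.
Proof. by rewrite integral_cst// [X in (_ * X)%E]probability_setT mule1. Qed.

Lemma measurable_fun_integral_pair {R : realType} {d d1 d2}
    {T : measurableType d} {T1 : measurableType d1} {T2 : measurableType d2}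
    (nu : probability T2 R) (phi : T1 * T2 -> \bar R) (X : T -> T1) :
  measurable_fun [set: (T1 * T2)%type] phi -> (forall u, (0 <= phi u)%E) ->
  measurable_fun [set: T] X ->
  measurable_fun [set: T] (fun t => (\int[nu]_z phi (X t, z))%E).
Proof.
move=> mphi phi0 mX.
have mF : measurable_fun [set: T1] (fun x => (\int[nu]_z phi (x, z))%E).
  exact: (measurable_fun_fubini_tonelli_F (m2 := nu) phi).
exact: (measurableT_comp mF mX).
Qed.

Lemma ge0_integralZl_real {R : realType} {d} {T : measurableType d}
    (mu : {measure set T -> \bar R}) (c : R) (f : T -> R) :
  measurable_fun [set: T] f -> (forall t, 0 <= f t) -> 0 <= c ->
  (\int[mu]_t (c * f t)%:E = c%:E * \int[mu]_t (f t)%:E)%E.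
Proof.
move=> mf f0 c0; under eq_integral do rewrite EFinM.
apply: ge0_integralZl_EFin => //; last exact/measurable_EFinP.
by move=> t _; rewrite lee_fin.
Qed.

(** * Independence *)

Section independence.
Context {R : realType} {disp} {Omega : measurableType disp}.
Variable P : probability Omega R.
Context {I : eqType}.
Variable E : I -> set_system Omega.

(** The pi-system generated by the families indexed by [Q]. Independence is checked on it by
    counting indices and passes to the generated sigma-algebra by uniqueness of measures. *)
Definition finI_system (Q : pred I) : set_system Omega :=
  [set A | exists J F, [/\ uniq J, all Q J, forall i, i \in J -> E i (F i)
    & A = \bigcap_(i in [set` J]) F i]].

Lemma finI_systemS (Q Q' : pred I) : (forall i, Q i -> Q' i) ->
  finI_system Q `<=` finI_system Q'.
Proof.
move=> QQ' A [J [F [uJ QJ EF ->]]]; exists J, F; split => //.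
by apply/allP => i iJ; apply: QQ'; exact: (allP QJ).
Qed.

Lemma finI_system1 (Q : pred I) i A : Q i -> E i A -> finI_system Q A.
Proof.
move=> Qi EA; exists [:: i], (fun=> A); split => //=; first by rewrite Qi.
  by move=> j; rewrite inE => /eqP ->.
by apply/seteqP; split=> [w Aw j _ //|w]; apply; rewrite /= inE.
Qed.

Hypothesis Em : forall i, E i `<=` measurable.
Hypothesis ET : forall i, E i setT.
Hypothesis EI : forall i, setI_closed (E i).

Lemma finI_systemT Q : finI_system Q setT.
Proof.
exists [::], (fun=> setT); split => //.
by apply/seteqP; split=> // w _ i; rewrite /= in_nil.
Qed.

Lemma finI_system_measurable Q : finI_system Q `<=` measurable.
Proof.
move=> A [J [F [_ _ EF ->]]]; apply: fin_bigcap_measurable => // i iJ.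
by apply: (Em (EF i _)).
Qed.

Lemma finI_system_setI Q : setI_closed (finI_system Q).
Proof.
move=> _ _ [J [F [uJ QJ EF ->]]] [J' [F' [uJ' QJ' EF' ->]]].
pose H i := (if i \in J then F i else setT) `&` (if i \in J' then F' i else setT).
exists (undup (J ++ J')), H; split; first exact: undup_uniq.
- apply/allP => i; rewrite mem_undup mem_cat => /orP[/(allP QJ)|/(allP QJ')] //.
- by move=> i _; apply: EI; case: ifP => // iJ; [exact: EF|exact: EF'].
- apply/seteqP; split => [w [wF wF'] i _|w wH].
    by split; case: ifP => // iJ; [exact: wF|exact: wF'].
  split=> i /= iJ.
    have /wH[] : [set` undup (J ++ J')] i by rewrite /= mem_undup mem_cat iJ.
    by rewrite iJ.
  have /wH[_] : [set` undup (J ++ J')] i by rewrite /= mem_undup mem_cat iJ orbT.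
  by rewrite iJ.
Qed.

Hypothesis indepE : mutually_independent P E.

(** As [Q] and [Q'] are disjoint, the two index lists concatenate without repetition, and mutual
    independence for the concatenation factorizes both intersections at once. *)
Lemma finI_system_indep (Q Q' : pred I) A B : (forall i, Q i -> ~~ Q' i) ->
  finI_system Q A -> finI_system Q' B -> P (A `&` B) = (P A * P B)%E.
Proof.
move=> QQ' [J [F [uJ QJ EF ->]]] [J' [F' [uJ' QJ' EF' ->]]].
pose H i := if i \in J then F i else F' i.
have JJ' i : i \in J' -> i \notin J.
  by move=> /(allP QJ') Q'i; apply/negP => /(allP QJ)/QQ'; rewrite Q'i.
have -> : (\bigcap_(i in [set` J]) F i) `&` (\bigcap_(i in [set` J']) F' i) =
    \bigcap_(i in [set` J ++ J']) H i.
  apply/seteqP; split => [w [wF wF'] i /=|w wH].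
    rewrite mem_cat /H; case: ifP => [iJ _|_ /=]; first exact: wF.
    exact: wF'.
  split=> i /= iJ.
    have : H i w by apply: wH; rewrite /= mem_cat iJ.
    by rewrite /H iJ.
  have : H i w by apply: wH; rewrite /= mem_cat iJ orbT.
  by rewrite /H (negbTE (JJ' _ iJ)).
rewrite !indepE//; last 2 first.
- rewrite cat_uniq uJ uJ' andbT; apply/hasPn => i; exact: JJ'.
- move=> i; rewrite mem_cat /H; case: ifP => [iJ _|_ /=]; first exact: EF.
  exact: EF'.
rewrite big_cat/=; congr (_ * _)%E; apply: eq_big_seq => i iJ.
  by rewrite /H iJ.
by rewrite /H (negbTE (JJ' _ iJ)).
Qed.

Lemma sigma_finI_measurable Q : <<s finI_system Q >> `<=` measurable.
Proof.
apply: smallest_sub; first exact: sigma_algebra_measurable.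
exact: finI_system_measurable.
Qed.

Lemma sigma_finI_indep (Q Q' : pred I) A B : (forall i, Q i -> ~~ Q' i) ->
  <<s finI_system Q >> A -> <<s finI_system Q' >> B ->
  P (A `&` B) = (P A * P B)%E.
Proof.
move=> QQ' sA sB.
(* For fixed [C], both sides are finite measures in [D] that agree on a pi-system. This is applied
   to each of the two events in turn. *)
have uniq_ext S C : finI_system S `<=` measurable -> measurable C ->
    (forall D, finI_system S D -> P (D `&` C) = (P D * P C)%E) ->
    forall D, <<s finI_system S >> D -> P (D `&` C) = (P D * P C)%E.
  move=> mS mC HD D sD.
  have PC0 : 0 <= fine (P C) by rewrite fine_ge0.
  have PCE : P C = (fine (P C))%:E by rewrite fineK// fin_num_measure.
  have cov : \bigcup_(k : nat) [set: Omega] = setT by apply: bigcup_const; exists 0%N.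
  have := @g_sigma_algebra_measure_unique _ R _ (finI_system S) mS (fun=> setT)
    (fun=> finI_systemT S) cov (mrestr P mC) (mscale (NngNum PC0) P)
    (@finI_system_setI S).
  move=> /(_ _ _ D sD); rewrite /= /mrestr /mscale /= -PCE => ->.
  - by rewrite muleC.
  - by move=> D' SD'; rewrite HD// muleC.
  - by move=> _; rewrite setTI ltey_eq fin_num_measure.
apply: (uniq_ext Q) => //; first exact: finI_system_measurable.
  exact: sigma_finI_measurable sB.
move=> D QD; rewrite setIC muleC.
apply: (uniq_ext Q') => //; first exact: finI_system_measurable.
  exact: finI_system_measurable QD.
move=> D' Q'D'; rewrite setIC muleC.
exact: finI_system_indep QD Q'D'.
Qed.

End independence.

(** Expressed as measurability on [g_sigma_algebraType G], so that the closure lemmas for measurable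
    functions apply to adapted maps unchanged. *)
Definition adapted {Omega : pointedType} {disp} {T : measurableType disp}
    (G : set_system Omega) (X : Omega -> T) : Prop :=
  measurable_fun [set: g_sigma_algebraType G] (X : g_sigma_algebraType G -> T).

Lemma adaptedP {Omega : pointedType} {disp} {T : measurableType disp}
    (G : set_system Omega) (X : Omega -> T) :
  adapted G X <-> forall A, measurable A -> <<s G >> (X @^-1` A).
Proof.
split=> [mX A mA|mX _ A mA].
  by have := mX measurableT A mA; rewrite setTI.
by rewrite setTI; exact: (mX A mA).
Qed.

Lemma adaptedS {Omega : pointedType} {disp} {T : measurableType disp}
    (G G' : set_system Omega) (X : Omega -> T) :
  G `<=` G' -> adapted G X -> adapted G' X.
Proof.
move=> GG' /adaptedP mX; apply/adaptedP => A /mX.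
apply: smallest_sub; first exact: smallest_sigma_algebra.
by move=> B /GG'; exact: sub_sigma_algebra.
Qed.

(** * Integrating out an independent variable *)

Section independent_pair.
Context {R : realType} {d0 d1 d2} {Omega : measurableType d0}
  {T1 : measurableType d1} {T2 : measurableType d2}.
Variables (P : probability Omega R) (X : Omega -> T1) (Z : Omega -> T2)
  (nu : probability T2 R).
Hypotheses (mX : measurable_fun [set: Omega] X)
  (mZ : measurable_fun [set: Omega] Z).
Hypothesis XZ : forall A B, measurable A -> measurable B ->
  P (X @^-1` A `&` Z @^-1` B) = (P (X @^-1` A) * nu B)%E.

(** The joint law of [X] and [Z] is the product of the law of [X] and [nu], so Tonelli integrates
    [Z] out with [X] frozen. This plays the part of conditioning on [X]. *)
Lemma ge0_integral_indep (phi : T1 * T2 -> \bar R) :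
  measurable_fun [set: (T1 * T2)%type] phi -> (forall u, (0 <= phi u)%E) ->
  (\int[P]_w phi (X w, Z w) = \int[P]_w \int[nu]_z phi (X w, z))%E.
Proof.
move=> mphi phi0.
pose Xf : {mfun Omega >-> T1} := HB.pack X (isMeasurableFun.Build _ _ _ _ X mX).
have mXZ : measurable_fun [set: Omega] (fun w => (X w, Z w)).
  exact: measurable_fun_pair.
pose XZf : {mfun Omega >-> (T1 * T2)%type} :=
  HB.pack (fun w => (X w, Z w)) (isMeasurableFun.Build _ _ _ _ _ mXZ).
have -> : (\int[P]_w phi (X w, Z w) = \int[distribution P XZf]_u phi u)%E.
  by rewrite ge0_integral_distribution.
rewrite (eq_measure_integral (distribution P Xf \x nu)%E); last first.
  move=> A mA _; apply/esym; apply: (product_measure_unique (m' := distribution P XZf)) => //.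
rewrite fubini_tonelli1//.
rewrite (@ge0_integral_distribution _ _ _ _ _ P Xf)//.
- exact: measurable_fun_fubini_tonelli_F.
- by move=> x; apply: integral_ge0.
Qed.

End independent_pair.

(** * Gaussian shifts *)

Section normal_shift.
Context {R : realType}.
Local Notation mu := (@lebesgue_measure R).

(** A translation keeps the length of half-open intervals, and this characterizes Lebesgue
    measure. *)
Lemma ge0_integral_lebesgue_shift (t : R) (f : R -> \bar R) :
  measurable_fun [set: R] f -> (forall x, (0 <= f x)%E) ->
  (\int[mu]_x f (x + t)%R = \int[mu]_x f x)%E.
Proof.
move=> mf f0.
have mt : measurable_fun [set: measurableTypeR R]
    ((fun x => x + t) : measurableTypeR R -> measurableTypeR R).
  by apply: measurable_funD => //; exact: measurable_cst.
transitivity (\int[pushforward mu ((fun x => (x + t)%R) :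
    measurableTypeR R -> measurableTypeR R)]_x f x)%E.
  by rewrite ge0_integral_pushforward.
apply: eq_measure_integral => A mA _; apply/esym.
pose tf : {mfun measurableTypeR R >-> measurableTypeR R} :=
  HB.pack ((fun x => x + t) : measurableTypeR R -> measurableTypeR R)
    (isMeasurableFun.Build _ _ _ _ _ mt).
apply: (lebesgue_measure_unique (mu := pushforward mu tf)) => //= _ [[a b]] _ <-.
rewrite /pushforward.
rewrite (_ : _ @^-1` _ = `]a - t, b - t]%classic).
  rewrite !lebesgue_measure_itv/= !lte_fin ltrD2r; case: ifP => // _.
  by rewrite -!EFinD; congr (_%:E); ring.
by apply/seteqP; split=> x; rewrite /= !in_itv/= ltrBlDr lerBrDr.
Qed.

Lemma ge0_integral_normal_prob (f : R -> \bar R) :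
  measurable_fun [set: R] f -> (forall x, (0 <= f x)%E) ->
  (\int[normal_prob 0 1]_x f x = \int[mu]_x (f x * (normal_pdf 0 1 x)%:E))%E.
Proof.
move=> mf f0.
have := @ge0_integral_mdensity _ _ R mu _ (measurable_normal_pdf 0 1)
  (@normal_pdf_ge0 R 0 1) f f0 mf.
move=> <-.
exact: eq_measure_integral.
Qed.

(** Cameron-Martin formula in dimension one: at x + t, the factor exp (t x - t^2 / 2) evaluated
    there turns the Gaussian density back into its value at x. *)
Lemma normal_prob_shift (t : R) (A : set R) : measurable A ->
  normal_prob 0 1 [set x | A (x + t)] =
  (\int[normal_prob 0 1]_(x in A) (expR (t * x - t ^+ 2 / 2))%:E)%E.
Proof.
move=> mA.
have mt : measurable_fun [set: R] (fun x => x + t).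
  by apply: measurable_funD => //; exact: measurable_cst.
have mAt : measurable [set x | A (x + t)].
  by have := mt measurableT A mA; rewrite setTI.
transitivity (\int[normal_prob 0 1]_x (\1_A (x + t))%:E)%E.
  have -> : (fun x => (\1_A (x + t))%:E) =
      (fun x => (\1_[set x | A (x + t)] x)%:E) :> (R -> \bar R).
    by apply/funext => x; rewrite !indicE; congr (_%:R%:E); apply/idP/idP; rewrite !inE.
  by rewrite integral_indic// setIT.
have mI : measurable_fun [set: R] (EFin \o (\1_A : R -> R)).
  exact/measurable_EFinP.
have mIt : measurable_fun [set: R] (fun x => (\1_A (x + t))%:E : \bar R).
  exact: (measurableT_comp mI mt).
have me : measurable_fun [set: R] (fun x => (expR (t * x - t ^+ 2 / 2))%:E).
  apply/measurable_EFinP; apply: measurableT_comp => //.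
  by apply: measurable_funB => //; exact: measurable_cst.
have mp := @measurable_normal_pdf R 0 1.
rewrite ge0_integral_normal_prob//.
rewrite [RHS]integral_mkcond ge0_integral_normal_prob//; last 2 first.
- by apply/(measurable_restrictT _ _).1 => //; exact: measurable_funTS.
- by move=> x; rewrite patchE; case: ifP => // _; rewrite lee_fin expR_ge0.
rewrite -[RHS](ge0_integral_lebesgue_shift t); last 2 first.
- apply: emeasurable_funM; last exact/measurable_EFinP.
  by apply/(measurable_restrictT _ _).1 => //; exact: measurable_funTS.
- move=> x; apply: mule_ge0; last by rewrite lee_fin normal_pdf_ge0.
  by rewrite patchE; case: ifP => // _; rewrite lee_fin expR_ge0.
apply: eq_integral => x _; rewrite patchE indicE.
case: ifP => _; rewrite ?mul0e// mul1e -EFinM; congr (_%:E).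
rewrite /normal_pdf oner_eq0 /normal_fun mulrCA -expRD; congr (_ * expR _).
by rewrite expr1n; field.
Qed.

End normal_shift.

(** Boxes form a pi-system, and they generate because the preimage of a set by one coordinate is the
    box whose other sides are full. Used for row vectors and for tuples. *)
Lemma g_sigma_preimage_unique {R : realType} {d d'} {aT : measurableType d}
    {rT : measurableType d'} n (f : 'I_n -> aT -> rT)
    (m1 : probability aT R) (m2 : {measure set aT -> \bar R}) :
  measurable = g_sigma_preimage f ->
  (forall A : 'I_n -> set rT, (forall i, measurable (A i)) ->
    m1 [set w | forall i, A i (f i w)] = m2 [set w | forall i, A i (f i w)]) ->
  forall B, measurable B -> m1 B = m2 B.
Proof.
move=> fE m12 B mB.
pose G := [set B | exists2 A : 'I_n -> set rT, (forall i, measurable (A i)) &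
  B = [set w | forall i, A i (f i w)]].
have GT : G setT.
  exists (fun=> setT) => //; by apply/seteqP; split.
have mf i A : measurable A -> measurable (f i @^-1` A).
  move=> mA; rewrite fE; apply: sub_sigma_algebra => /=.
  rewrite -bigcup_seq/=; exists i => /=; first by rewrite mem_index_enum.
  by exists A => //; rewrite setTI.
have mG : measurable = <<s G >>.
  rewrite fE; apply/seteqP; split; last first.
    rewrite -fE; apply: smallest_sub; first exact: sigma_algebra_measurable.
    move=> _ [A mA ->].
    rewrite (_ : [set w | _] = \bigcap_(i in [set` 'I_n]) (f i @^-1` A i)).
      apply: fin_bigcap_measurable => // i _; exact: mf.
    by apply/seteqP; split=> [w wA i _|w wA i]; [exact: wA|exact: wA i isT].
  apply: smallest_sub; first exact: smallest_sigma_algebra.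
  rewrite -bigcup_seq; apply: bigcup_sub => i _ _ [A mA <-].
  apply: sub_sigma_algebra; exists (fun j => if j == i then A else setT).
    by move=> j; case: ifP.
  rewrite setTI; apply/seteqP; split=> w wA /=.
    by move=> j; case: eqP => // ->.
  by have := wA i; rewrite eqxx.
apply: (measure_unique G (fun=> setT)) => //.
- move=> _ _ [A mA ->] [A' mA' ->]; exists (fun i => A i `&` A' i).
    by move=> i; exact: measurableI.
  apply/seteqP; split=> [w [wA wA'] i|w wA]; first by split.
  by split=> i; have [] := wA i.
- by apply: bigcup_const; exists 0%N.
- by move=> _ [A mA ->]; exact: m12.
- by move=> _; rewrite ltey_eq fin_num_measure.
Qed.

Definition gaussian_measure {R : realType} {n : nat}
    (gam : probability 'rV[R]_n R) : Prop :=
  forall A : 'I_n -> set R, (forall i, measurable (A i)) ->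
    gam [set v | forall i, A i (v ord0 i)] =
    (\prod_(i < n) normal_prob 0 1 (A i))%E.

Lemma gaussian_measure_unique {R : realType} {n : nat}
    (gam gam' : probability 'rV[R]_n R) :
  gaussian_measure gam -> gaussian_measure gam' ->
  forall B, measurable B -> gam B = gam' B.
Proof.
move=> g g'; apply: (@g_sigma_preimage_unique R _ _ _ _ n
  (fun i (v : 'rV[R]_n) => v ord0 i)) => //.
by move=> A mA; exact: etrans (g A mA) (esym (g' A mA)).
Qed.

Lemma std_gaussian_distribution {R : realType} {disp}
    {Omega : measurableType disp} {P : probability Omega R} {n : nat}
    (X : {RV P >-> 'rV[R]_n}) :
  std_gaussian X -> gaussian_measure (distribution P X).
Proof. by move=> sX A mA; rewrite -sX. Qed.

Section gaussian_shift.
Context {R : realType} {n : nat}.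
Variable gam : probability 'rV[R]_n R.
Hypothesis gamE : gaussian_measure gam.
Local Open Scope ereal_scope.

(** Both sides integrate [psi] against a measure, the image of [gam] by the shift or [gam] with a
    density, so boxes suffice. There only the side [j] is affected, and the formula in dimension one
    applies. *)
Lemma ge0_integral_gaussian_shift1 (j : 'I_n) (t : R) (psi : 'rV[R]_n -> \bar R) :
  measurable_fun [set: 'rV[R]_n] psi -> (forall v, 0 <= psi v) ->
  \int[gam]_e psi (e + t *: delta_mx ord0 j)%R =
  \int[gam]_e (psi e * (expR (t * e ord0 j - t ^+ 2 / 2))%:E).
Proof.
move=> mpsi psi0.
have mshift : measurable_fun [set: 'rV[R]_n]
    (fun e : 'rV[R]_n => (e + t *: delta_mx ord0 j)%R).
  by apply: measurable_rowD => //; exact: measurable_cst.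
pose shift : {mfun 'rV[R]_n >-> 'rV[R]_n} :=
  HB.pack (fun e : 'rV[R]_n => (e + t *: delta_mx ord0 j)%R)
    (isMeasurableFun.Build _ _ _ _ _ mshift).
pose g (x : R) := (expR (t * x - t ^+ 2 / 2)).
have mg : measurable_fun [set: R] g.
  apply: measurableT_comp => //.
  by apply: measurable_funB => //; exact: measurable_cst.
have mgj : measurable_fun [set: 'rV[R]_n] (fun e : 'rV[R]_n => g (e ord0 j)).
  exact: (measurableT_comp mg (measurable_rVcoord j)).
have g0 (e : 'rV[R]_n) : (0 <= g (e ord0 j))%R by exact: expR_ge0.
transitivity (\int[distribution gam shift]_e psi e).
  by rewrite (@ge0_integral_distribution _ _ _ _ _ gam shift).
rewrite -(ge0_integral_mdensity gam mgj g0)//.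
apply: eq_measure_integral => A mA _.
apply: (@g_sigma_preimage_unique R _ _ _ _ n
  (fun i (v : 'rV[R]_n) => v ord0 i) (distribution gam shift)
  (mdensity gam mgj g0)) => //.
move=> {psi mpsi psi0 A mA} A mA.
(* Mass of the sides other than [j], which stays fixed while side [j] varies. *)
pose c := (\prod_(i < n | i != j) fine (normal_prob 0 1 (A i)))%R.
have c0 : (0 <= c)%R by apply: prodr_ge0 => i _; exact: fine_ge0.
have gamA B : measurable B ->
    gam [set v | forall i, (if i == j then B else A i) (v ord0 i)] =
    normal_prob 0 1 B * c%:E.
  move=> mB; apply: etrans (gamE (A := fun i => if i == j then B else A i) _) _.
    by move=> i; case: ifP.
  rewrite (bigD1 j)//= eqxx; congr (_ * _).
  rewrite -prodEFin; apply: eq_bigr => i /negbTE ->.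
  by rewrite fineK//; apply: (fin_num_measure (normal_prob 0 1)); exact: mA.
have mAt : measurable [set x | A j (x + t)%R].
  have mt : measurable_fun [set: R] (fun x => x + t)%R.
    by apply: measurable_funD => //; exact: measurable_cst.
  by have := mt measurableT (A j) (mA j); rewrite setTI.
transitivity (gam [set v | forall i,
    (if i == j then [set x | A j (x + t)%R] else A i) (v ord0 i)]).
  congr (gam _).
  apply/seteqP; split=> v /= vA i; have := vA i; rewrite !mxE/=.
    by case: eqP => [->|_]; rewrite ?mulr1 ?mulr0 ?addr0.
  by case: eqP => [->|_]; rewrite ?mulr1 ?mulr0 ?addr0.
rewrite gamA// normal_prob_shift//.
(* Restricted to [C], the measure [gam] has [c] times N(0, 1) as its marginal of index [j]. *)
pose C := [set v : 'rV[R]_n | forall i, (if i == j then setT else A i) (v ord0 i)].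
have mC : measurable C.
  rewrite (_ : C = \bigcap_(i in [set` 'I_n])
     ((fun v : 'rV[R]_n => v ord0 i) @^-1` (if i == j then setT else A i))).
    apply: fin_bigcap_measurable => // i _.
    rewrite -[X in measurable X]setTI; apply: measurable_rVcoord => //.
    by case: ifP.
  by apply/seteqP; split=> [w wA i _|w wA i]; [exact: wA|exact: wA i isT].
have mI : measurable_fun [set: 'rV[R]_n] (\1_C : _ -> R) by exact: measurable_indic.
have I0 v : (0 <= \1_C v :> R)%R by [].
pose phi := ((EFin \o g) \_ (A j)).
have mphi : measurable_fun [set: R] phi.
  apply/(measurable_restrictT _ _).1 => //.
  by apply/measurable_EFinP; exact: measurable_funTS.
have phi0 x : 0 <= phi x.
  by rewrite /phi patchE; case: ifP => // _; rewrite lee_fin expR_ge0.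
transitivity (\int[gam]_v (phi (v ord0 j) * (\1_C v)%:E)); last first.
  rewrite /mdensity/= [RHS]integral_mkcond.
  apply: eq_integral => v _; rewrite !patchE /phi patchE indicE.
  case: ifPn => vAj; case: (boolP (v \in C)) => vC; rewrite ?mule1 ?mule0 ?mul0e.
  - rewrite ifT//; rewrite inE/=; move: vC vAj; rewrite !inE/= => vC vAj i.
    by have := vC i; case: eqP => [->|].
  - rewrite ifF//; apply/negP; rewrite inE => /= vA; move/negP: vC; apply.
    by rewrite inE/= => i; case: ifP => // _; exact: vA.
  - by rewrite ifF//; apply/negP; rewrite inE => /= vA; move/negP: vAj; apply; rewrite inE.
  - by rewrite ifF//; apply/negP; rewrite inE => /= vA; move/negP: vAj; apply; rewrite inE.
have mcoordj : measurable_fun [set: 'rV[R]_n]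
    (fun e => e ord0 j : measurableTypeR R) := measurable_rVcoord j.
pose coordj : {mfun 'rV[R]_n >-> measurableTypeR R} :=
  HB.pack (fun e : 'rV[R]_n => e ord0 j : measurableTypeR R)
    (isMeasurableFun.Build _ _ _ _ _ mcoordj).
rewrite -(ge0_integral_mdensity gam mI I0 (f := phi \o coordj)); last 2 first.
- by move=> v; exact: phi0.
- exact: measurableT_comp.
transitivity (\int[pushforward (mdensity gam mI I0) coordj]_x phi x); last first.
  by rewrite ge0_integral_pushforward.
transitivity (\int[mscale (NngNum c0) (normal_prob 0 1)]_x phi x); last first.
  apply/esym; apply: (eq_measure_integral (mscale (NngNum c0) (normal_prob 0 1))).
  move=> B mB _; rewrite /= /pushforward /mdensity /mscale/=.
  have mBj : measurable ((fun e : 'rV[R]_n => e ord0 j) @^-1` B).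
    by rewrite -[X in measurable X]setTI; exact: measurable_rVcoord.
  rewrite integral_indic// muleC; apply: etrans _ (gamA B mB); congr (gam _).
  apply/seteqP; split=> [v [vC vB] i|v vB].
    by have := vC i; case: eqP => [->|].
  split; last by have := vB j; rewrite eqxx.
  by move=> i; have := vB i; case: ifP.
rewrite ge0_integral_mscale//.
by rewrite muleC; congr (_ * _); exact: integral_mkcond.
Qed.

(** Density of N(v, I) with respect to N(0, I) at [u]. *)
Definition tilt (v u : 'rV[R]_n) : R := expR (dotv v u - dotv v v / 2).

Lemma ge0_integral_gaussian_shift (v : 'rV[R]_n) (psi : 'rV[R]_n -> \bar R) :
  measurable_fun [set: 'rV[R]_n] psi -> (forall v, 0 <= psi v) ->
  \int[gam]_e psi (v + e)%R = \int[gam]_e (psi e * (tilt v e)%:E).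
Proof.
move=> mpsi psi0.
(* Shifts one coordinate at a time; in a list without repetition, the density of the remaining
   coordinates does not see the shift along the head. *)
suff H (r : seq 'I_n) : uniq r -> forall psi : 'rV[R]_n -> \bar R,
    measurable_fun [set: 'rV[R]_n] psi -> (forall v, 0 <= psi v) ->
    \int[gam]_e psi (\sum_(i <- r) v ord0 i *: delta_mx ord0 i + e)%R =
    \int[gam]_e (psi e * (expR (\sum_(i <- r)
      (v ord0 i * e ord0 i - v ord0 i ^+ 2 / 2)))%:E).
  have := H _ (index_enum_uniq 'I_n) psi mpsi psi0.
  rewrite -row_sum_delta => ->; apply: eq_integral => e _.
  congr (_ * (expR _)%:E); rewrite /dotv sumrB mulr_suml; congr (_ - _)%R.
elim: r => [_|j r IH /= /andP[jr ur]] {}psi {}mpsi {}psi0.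
  by apply: eq_integral => e _; rewrite !big_nil add0r expR0 mule1.
pose chi e := psi (v ord0 j *: delta_mx ord0 j + e)%R.
have mchi : measurable_fun [set: 'rV[R]_n] chi.
  apply: (measurableT_comp mpsi).
  by apply: measurable_rowD => //; exact: measurable_cst.
transitivity (\int[gam]_e chi (\sum_(i <- r) v ord0 i *: delta_mx ord0 i + e)%R).
  by apply: eq_integral => e _; rewrite /chi big_cons addrA.
rewrite (IH ur chi mchi (fun e => psi0 _)).
pose G (e : 'rV[R]_n) := expR (\sum_(i <- r) (v ord0 i * e ord0 i - v ord0 i ^+ 2 / 2)).
have mG : measurable_fun [set: 'rV[R]_n] (fun e => (G e)%:E).
  apply/measurable_EFinP; apply: measurableT_comp => //.
  apply: measurable_sum => i; apply: measurable_funB => //.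
  by apply: measurable_funM => //; exact: measurable_rVcoord.
have Gj t e : G (e + t *: delta_mx ord0 j)%R = G e.
  rewrite /G; congr expR; apply: eq_big_seq => i ir.
  rewrite !mxE eqxx/=; case: eqP => [ij|_]; last by rewrite mulr0 addr0.
  by move: jr; rewrite -ij ir.
transitivity (\int[gam]_e ((psi e * (G e)%:E) *
    (expR (v ord0 j * e ord0 j - v ord0 j ^+ 2 / 2))%:E)).
  have mpsiG : measurable_fun [set: 'rV[R]_n] (fun e => psi e * (G e)%:E).
    exact: emeasurable_funM.
  have psiG0 e : 0 <= psi e * (G e)%:E.
    by apply: mule_ge0; [exact: psi0|rewrite lee_fin expR_ge0].
  rewrite -(ge0_integral_gaussian_shift1 j (v ord0 j) mpsiG psiG0).
  by apply: eq_integral => e _; rewrite Gj /chi addrC.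
apply: eq_integral => e _; rewrite -muleA -EFinM big_cons -expRD.
by congr (_ * (expR _)%:E); rewrite addrC.
Qed.

End gaussian_shift.

(** * Exponential moments of sums of bounded centered vectors *)

Lemma ge0_le_integral_EFin {R : realType} {d} {T : measurableType d}
    (mu : {measure set T -> \bar R}) (f g : T -> R) :
  measurable_fun [set: T] f -> measurable_fun [set: T] g ->
  (forall t, 0 <= f t) -> (forall t, f t <= g t) ->
  (\int[mu]_t (f t)%:E <= \int[mu]_t (g t)%:E)%E.
Proof.
move=> mf mg f0 fg; apply: ge0_le_integral => //.
- by move=> t _; rewrite lee_fin.
- exact/measurable_EFinP.
- exact/measurable_EFinP.
- by move=> t _; rewrite lee_fin.
Qed.

Section exponential_inequalities.
Context {R : realType}.

(** Squaring exp (y / 2) <= 1 / (1 - y / 2) reduces the claim to a polynomial inequality whose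
    difference factors with a factor 1 - y. *)
Lemma expR_le_quadratic (y : R) : y <= 1 -> expR y <= 1 + y + 2 * y ^+ 2.
Proof.
move=> y1.
have e1 : 1 - y / 2 <= expR (- (y / 2)) by apply: expR_ge1Dx.
have p : 0 < 1 - y / 2 by lra.
have e2 : expR (y / 2) <= (1 - y / 2)^-1.
  by rewrite -[expR _]invrK -expRN lef_pV2// posrE ?expR_gt0.
have -> : expR y = expR (y / 2) ^+ 2 by rewrite -expRM_natl; congr expR; field.
apply: (@le_trans _ _ ((1 - y / 2)^-1 ^+ 2)).
  by rewrite lerXn2r// nnegrE ?expR_ge0 ?invr_ge0 ?ltW.
rewrite exprVn -[leLHS]mul1r ler_pdivrMr ?exprn_gt0//.
rewrite -subr_ge0.
have -> : (1 + y + 2 * y ^+ 2) * (1 - y / 2) ^+ 2 - 1 =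
  y ^+ 2 * ((1 - y) * (5 / 4 - y / 2)) by field.
by apply: mulr_ge0; [exact: sqr_ge0|apply: mulr_ge0; lra].
Qed.

(** The linear term integrates to 0 for a centered variable, which leaves a sub-Gaussian bound
    without a leading constant. For y <= 1 the quadratic bound suffices; for y > 1, y <= 2 y^2. *)
Lemma expR_le_add_sqr (y : R) : expR y <= y + expR (2 * y ^+ 2).
Proof.
have [y1|y1] := leP y 1.
  apply: le_trans (expR_le_quadratic y1) _.
  have := expR_ge1Dx (2 * y ^+ 2); lra.
apply: (@le_trans _ _ (expR (2 * y ^+ 2))); last by rewrite lerDr; lra.
by rewrite ler_expR expr2; nra.
Qed.

End exponential_inequalities.

Section bounded_centered.
Context {R : realType} {d} {Xi : measurableType d} (nu : probability Xi R).

Lemma integral_expR_centered (Y : Xi -> R) (b : R) :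
  measurable_fun [set: Xi] Y -> (forall z, Y z ^+ 2 <= b) ->
  (\int[nu]_z (Y z)%:E = 0)%E ->
  (\int[nu]_z (expR (Y z))%:E <= (expR (2 * b))%:E)%E.
Proof.
move=> mY Yb Y0.
have iY : nu.-integrable [set: Xi] (EFin \o Y).
  apply: measurable_bounded_integrable => //.
    by rewrite ltey_eq fin_num_measure.
  exists (1 + b); split; first by rewrite num_real.
  move=> c bc z _ /=; apply: le_trans (ltW bc).
  have := Yb z; rewrite -[X in X <= _]real_normK ?num_real// => h.
  have := normr_ge0 (Y z); nra.
have ic : nu.-integrable [set: Xi] (EFin \o cst (expR (2 * b))).
  by apply: finite_measure_integrable_cst.
apply: (@le_trans _ _ (\int[nu]_z ((EFin \o Y) z + (EFin \o cst (expR (2 * b))) z))%E).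
  apply: ge0_le_integral => //.
  - by apply/measurable_EFinP; exact: measurableT_comp.
  - by apply/measurable_EFinP; apply: measurable_funD.
  - move=> z _; rewrite /= lee_fin; apply: le_trans (expR_le_add_sqr _) _.
    by rewrite lerD2l ler_expR ler_pM2l// Yb.
rewrite integralD// [X in (X + _)%E]Y0 add0e.
by rewrite (integral_probability_cst nu (expR (2 * b))%:E).
Qed.

Context {n : nat}.
Variables (zeta : Xi -> 'rV[R]_n) (r : R).
Hypotheses (mzeta : measurable_fun [set: Xi] zeta) (r0 : 0 <= r)
  (zetar : forall z, enorm (zeta z) <= r)
  (zeta0 : forall i, (\int[nu]_z (zeta z ord0 i)%:E = 0)%E).

Let zeta_sqr z : dotv (zeta z) (zeta z) <= r ^+ 2.
Proof. by rewrite -enorm_sqr lerXn2r// nnegrE ?enorm_ge0. Qed.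

Lemma integrable_bounded_coord i :
  nu.-integrable [set: Xi] (fun z => (zeta z ord0 i)%:E).
Proof.
have mzi : measurable_fun [set: Xi] (fun z => zeta z ord0 i).
  exact: ((measurable_fun_rVP _).1 mzeta i).
apply: measurable_bounded_integrable => //.
  by rewrite ltey_eq fin_num_measure.
exists (1 + r ^+ 2); split; first by rewrite num_real.
move=> c bc z _ /=; apply: le_trans (ltW bc).
have : zeta z ord0 i ^+ 2 <= r ^+ 2.
  apply: le_trans (zeta_sqr z); rewrite /dotv (bigD1 i)//= -expr2 lerDl.
  by apply: sumr_ge0 => j _; rewrite -expr2 sqr_ge0.
rewrite -[X in X <= _]real_normK ?num_real// => h.
have := normr_ge0 (zeta z ord0 i); nra.
Qed.

Lemma integral_dotv_centered (theta : 'rV[R]_n) :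
  (\int[nu]_z (dotv theta (zeta z))%:E = 0)%E.
Proof.
under eq_integral do rewrite /dotv -sumEFin.
under eq_integral do under eq_bigr do rewrite EFinM.
rewrite integral_sum//; last by move=> i; apply: integrableZl => //; exact: integrable_bounded_coord.
apply: big1 => i _; rewrite integralZl ?zeta0 ?mule0//.
exact: integrable_bounded_coord.
Qed.

(** By Cauchy-Schwarz <theta, zeta>^2 <= r^2 |theta|^2, so a scalar bound applies and the dimension
    never enters. *)
Lemma integral_expR_dotv (theta : 'rV[R]_n) :
  (\int[nu]_z (expR (dotv theta (zeta z)))%:E <=
   (expR (2 * (r ^+ 2 * dotv theta theta)))%:E)%E.
Proof.
apply: integral_expR_centered.
- by apply: measurable_dotv.
- move=> z; apply: le_trans (dotv_sqr_le _ _) _.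
  by rewrite mulrC ler_wpM2r// dotv_ge0.
- exact: integral_dotv_centered.
Qed.

Context {d'} {Omega : measurableType d'} (P : probability Omega R).
Variables (S : nat -> Omega -> 'rV[R]_n) (xi : nat -> Omega -> Xi) (B : nat).
Hypotheses (mS : forall k, measurable_fun [set: Omega] (S k))
  (mxi : forall k, measurable_fun [set: Omega] (xi k))
  (S0 : forall w, S 0%N w = 0)
  (SS : forall k w, (k < B)%N -> S k.+1 w = S k w + zeta (xi k w))
  (Sxi : forall k (phi : 'rV[R]_n * Xi -> \bar R), (k < B)%N ->
    measurable_fun [set: ('rV[R]_n * Xi)%type] phi -> (forall u, (0 <= phi u)%E) ->
    (\int[P]_w phi (S k w, xi k w) = \int[P]_w \int[nu]_z phi (S k w, z))%E).

Lemma integral_expR_dotv_sum (theta : 'rV[R]_n) k : (k <= B)%N ->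
  (\int[P]_w (expR (dotv theta (S k w)))%:E <=
   (expR (2 * k%:R * r ^+ 2 * dotv theta theta))%:E)%E.
Proof.
elim: k => [_|k IH kB].
  under eq_integral do rewrite S0 dotvC dot0v expR0.
  by rewrite integral_probability_cst mulr0 !mul0r expR0.
pose phi (u : 'rV[R]_n * Xi) := (expR (dotv theta u.1 + dotv theta (zeta u.2)))%:E.
have mphi : measurable_fun [set: ('rV[R]_n * Xi)%type] phi.
  apply/measurable_EFinP; apply: measurableT_comp => //.
  apply: measurable_funD; apply: measurable_dotv => //.
  exact: measurableT_comp.
have -> : (\int[P]_w (expR (dotv theta (S k.+1 w)))%:E =
    \int[P]_w phi (S k w, xi k w))%E.
  by apply: eq_integral => w _; rewrite SS// dotvDr.
rewrite Sxi//; last by move=> u; rewrite lee_fin expR_ge0.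
pose c := expR (2 * (r ^+ 2 * dotv theta theta)).
apply: (@le_trans _ _ (\int[P]_w (c * expR (dotv theta (S k w)))%:E)%E).
  apply: ge0_le_integral => //.
  - by move=> w _; apply: integral_ge0 => z _; rewrite lee_fin expR_ge0.
  - apply: measurable_fun_integral_pair => //.
    by move=> u; rewrite lee_fin expR_ge0.
  - apply/measurable_EFinP; apply: measurable_funM => //.
    by apply: measurableT_comp => //; apply: measurable_dotv.
  - move=> w _; rewrite /phi/=.
    under eq_integral do rewrite expRD.
    rewrite ge0_integralZl_real ?expR_ge0//; last first.
      by apply: measurableT_comp => //; apply: measurable_dotv.
    rewrite mulrC EFinM; apply: lee_wpmul2l; first by rewrite lee_fin expR_ge0.
    exact: integral_expR_dotv.
rewrite ge0_integralZl_real ?expR_ge0//; last first.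
  by apply: measurableT_comp => //; apply: measurable_dotv.
apply: le_trans (lee_wpmul2l _ (IH (ltnW kB))) _; first by rewrite lee_fin expR_ge0.
rewrite -EFinM -expRD lee_fin ler_expR -[in leRHS]natr1 le_eqVlt; apply/orP; left.
by apply/eqP; ring.
Qed.

(* Integrating out the last summand turns [s] into [s (1 + 8 s r^2)]; the condition
   [16 s k r^2 <= 1] keeps this below [2 s] along the whole induction. *)
Lemma integral_expR_sqr_sum k (s : R) : (k <= B)%N -> 0 <= s ->
  16 * s * k%:R * r ^+ 2 <= 1 ->
  (\int[P]_w (expR (s * dotv (S k w) (S k w)))%:E <=
   (expR (2 * s * k%:R * r ^+ 2))%:E)%E.
Proof.
elim: k s => [s _ _ _|k IH s kB s0 sk].
  under eq_integral do rewrite S0 dot0v mulr0 expR0.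
  by rewrite integral_probability_cst mulr0 !mul0r expR0.
(* Expanding |S + zeta|^2 and bounding |zeta|^2 by r^2 leaves an exponent linear in zeta, in the
   direction 2 s S that is frozen while zeta is integrated. *)
pose phi (u : 'rV[R]_n * Xi) :=
  (expR (s * dotv u.1 u.1 + s * r ^+ 2 + dotv ((2 * s) *: u.1) (zeta u.2)))%:E.
have mphi : measurable_fun [set: ('rV[R]_n * Xi)%type] phi.
  apply/measurable_EFinP; apply: measurableT_comp => //.
  apply: measurable_funD.
    apply: measurable_funD => //; apply: measurable_funM => //.
    exact: measurable_dotv.
  apply: measurable_dotv; last exact: measurableT_comp.
  by apply: measurable_rowZ => //; exact: measurable_cst.
have phi0 u : (0 <= phi u)%E by rewrite lee_fin expR_ge0.
apply: (@le_trans _ _ (\int[P]_w phi (S k w, xi k w))%E).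
  apply: ge0_le_integral => //.
  - apply/measurable_EFinP; apply: measurableT_comp => //.
    by apply: measurable_funM => //; exact: measurable_dotv.
  - apply: (measurableT_comp mphi); exact: measurable_fun_pair.
  - move=> w _; rewrite lee_fin ler_expR SS//= !(dotvDl, dotvDr) dotvZl.
    rewrite (dotvC (zeta _) (S k w)).
    by have := zeta_sqr (xi k w); nra.
rewrite Sxi//.
pose s' := s * (1 + 8 * s * r ^+ 2).
have r20 : 0 <= r ^+ 2 by exact: sqr_ge0.
have k0 : 0 <= k%:R :> R by exact: ler0n.
have kS : k.+1%:R = k%:R + 1 :> R by rewrite natr1.
rewrite kS in sk *.
have sr0 : 0 <= s * r ^+ 2 by exact: mulr_ge0.
have skr0 : 0 <= s * k%:R * r ^+ 2 by rewrite mulr_ge0// mulr_ge0.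
apply: (@le_trans _ _ (\int[P]_w (expR (s * r ^+ 2) *
    expR (s' * dotv (S k w) (S k w)))%:E)%E).
  apply: ge0_le_integral => //.
  - by move=> w _; apply: integral_ge0 => z _.
  - exact: measurable_fun_integral_pair.
  - apply/measurable_EFinP; apply: measurable_funM => //.
    by apply: measurableT_comp => //; apply: measurable_funM => //; exact: measurable_dotv.
  - move=> w _; rewrite /phi/=.
    under eq_integral do rewrite expRD.
    rewrite ge0_integralZl_real ?expR_ge0//; last first.
      by apply: measurableT_comp => //; apply: measurable_dotv.
    apply: le_trans (lee_wpmul2l _ (integral_expR_dotv _)) _.
      by rewrite lee_fin expR_ge0.
    rewrite -EFinM -!expRD lee_fin ler_expR dotvZl dotvZr /s' le_eqVlt.
    by apply/orP; left; apply/eqP; ring.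
rewrite ge0_integralZl_real ?expR_ge0//; last first.
  apply: measurableT_comp => //; apply: measurable_funM => //.
  exact: measurable_dotv.
apply: le_trans (lee_wpmul2l _ (IH s' (ltnW kB) _ _)) _.
- by rewrite lee_fin expR_ge0.
- by rewrite /s' mulr_ge0// addr_ge0// -mulrA mulr_ge0.
- rewrite /s'.
  have -> : 16 * (s * (1 + 8 * s * r ^+ 2)) * k%:R * r ^+ 2 =
    16 * (s * k%:R * r ^+ 2) + 8 * (s * r ^+ 2) * (16 * (s * k%:R * r ^+ 2)) by ring.
  move: sk; rewrite (_ : 16 * s * (k%:R + 1) * r ^+ 2 =
    16 * (s * k%:R * r ^+ 2) + 16 * (s * r ^+ 2)); last by ring.
  by nra.
- rewrite -EFinM -expRD lee_fin ler_expR /s'.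
  have -> : 2 * (s * (1 + 8 * s * r ^+ 2)) * k%:R * r ^+ 2 =
    2 * (s * k%:R * r ^+ 2) + (s * r ^+ 2) * (16 * (s * k%:R * r ^+ 2)) by ring.
  move: sk; rewrite (_ : 16 * s * (k%:R + 1) * r ^+ 2 =
    16 * (s * k%:R * r ^+ 2) + 16 * (s * r ^+ 2)); last by ring.
  by nra.
Qed.

End bounded_centered.

(** * The Gibbs variational bound *)

Lemma measurable_lne {R : realType} : measurable_fun [set: \bar R] (@lne R).
Proof.
have -> : @lne R = fun x => if (x <= 0)%E then -oo%E else
    if (x < +oo)%E then (ln (fine x))%:E else +oo%E.
  apply/funext => -[r| |] /=; rewrite ?ltry ?ltxx ?leNye//=.
apply: measurable_fun_ifT => //=.
- by apply: measurable_fun_lee.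
- apply: measurable_fun_ifT => //=.
  + by apply: measurable_fun_lte.
  + by apply/measurable_EFinP; apply: measurableT_comp => //; exact: measurable_ln.
Qed.

(** Comparing positive and negative parts avoids integrability, which is not known beforehand for
    the logarithm of a density. *)
Lemma le_integralT {R : realType} {d} {T : measurableType d}
    (mu : {measure set T -> \bar R}) (f g : T -> \bar R) :
  measurable_fun [set: T] f -> measurable_fun [set: T] g ->
  (forall t, (f t <= g t)%E) -> (\int[mu]_t f t <= \int[mu]_t g t)%E.
Proof.
move=> mf mg fg; rewrite [leLHS]integralE [leRHS]integralE; apply: leeB.
  apply: ge0_le_integral => //; try exact: measurable_funepos.
  by move=> t _; apply: (@funepos_le _ _ setT) => //; rewrite inE.
apply: ge0_le_integral => //; try exact: measurable_funeneg.
by move=> t _; apply: (@funeneg_le _ _ setT) => //; rewrite inE.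
Qed.

Lemma integral_distributionT {R : realType} {d d'} {T : measurableType d}
    {T' : measurableType d'} (P : probability T R) (X : {RV P >-> T'})
    (f : T' -> \bar R) : measurable_fun [set: T'] f ->
  (\int[distribution P X]_y f y = \int[P]_w f (X w))%E.
Proof.
move=> mf; rewrite [LHS]integralE [RHS]integralE.
rewrite !(@ge0_integral_distribution _ _ _ _ _ P X)//.
- by congr (_ - _)%E; apply: eq_integral => w _; rewrite /= ?funeposE ?funenegE.
- exact: measurable_funeneg.
- exact: measurable_funepos.
Qed.

Section KL_change_of_measure.
Context {R : realType} {d d' d''} {Omega : measurableType d}
  {Omega' : measurableType d'} {T : measurableType d''}
  {P : probability Omega R} {P' : probability Omega' R}.
Variables (Y : {RV P >-> T}) (X : {RV P' >-> T}) (W g : Omega' -> R) (m b : R).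
Hypotheses (mW : measurable_fun [set: Omega'] W) (W0 : forall w, 0 < W w).
Hypothesis WXY : forall phi : T -> \bar R, measurable_fun [set: T] phi ->
  (forall t, (0 <= phi t)%E) ->
  (\int[P']_w (phi (X w) * (W w)%:E) <= \int[P]_w phi (Y w))%E.
Hypotheses (mg : measurable_fun [set: Omega'] g) (g0 : forall w, 0 <= g w)
  (Wg : forall w, - ln (W w) <= g w - m)
  (intg : (\int[P']_w (g w)%:E <= (m + b)%:E)%E).

Let mX : measurable_fun [set: Omega'] X. Proof. by []. Qed.

(** For a null set [A], the inequality [WXY] at the indicator of [A] forces 1_A(X) W = 0 almost
    surely, and [W] is positive. *)
Lemma change_of_measure_dominates : distribution P' X `<< distribution P Y.
Proof.
apply/null_content_dominatesP => A mA YA0.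
have mXA : measurable (X @^-1` A).
  by rewrite -[Y in measurable Y]setTI; exact: mX.
have mI : measurable_fun [set: T] (fun t => (\1_A t)%:E : \bar R).
  exact/measurable_EFinP.
have I0 t : (0 <= (\1_A t)%:E :> \bar R)%E by rewrite lee_fin.
have := WXY mI I0.
have -> : (\int[P]_w (\1_A (Y w))%:E = 0)%E.
  rewrite -YA0; transitivity (\int[distribution P Y]_t (\1_A t)%:E)%E.
    by rewrite (@ge0_integral_distribution _ _ _ _ _ P Y).
  by rewrite integral_indic// setIT.
have mF : measurable_fun [set: Omega'] (fun w => ((\1_A (X w))%:E * (W w)%:E)%E).
  apply: emeasurable_funM; last exact/measurable_EFinP.
  exact: (measurableT_comp mI mX).
have F0 w : (0 <= (\1_A (X w))%:E * (W w)%:E)%E.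
  by rewrite mule_ge0 ?lee_fin// ltW.
move=> int_le0.
have int0 : (\int[P']_w `|(\1_A (X w))%:E * (W w)%:E| = 0)%E.
  apply/eqP; rewrite eq_le; apply/andP; split; last exact: integral_ge0.
  by apply: le_trans int_le0; under eq_integral do rewrite gee0_abs//.
have /ae_eq_integral_abs : measurable_fun [set: Omega']
  (fun w => ((\1_A (X w))%:E * (W w)%:E)%E) by [].
move=> /(_ P' measurableT) [+ _] => /(_ int0) [N [mN PN0 NX]].
apply/eqP; rewrite eq_le measure_ge0 andbT -PN0.
apply: (le_measure P'); rewrite ?inE//.
move=> w /= Aw; apply: NX => /= /(_ I)/eqP.
by rewrite indicE mem_set// mul1e eqe gt_eqF.
Qed.

(** With r the density, ln r(X) = ln (r(X) W) - ln W <= r(X) W - 1 + g - m. By [WXY] the product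
    r(X) W has expectation at most 1, which the -1 cancels, and g - m contributes at most b. *)
Lemma KL_le : (KL (distribution P' X) (distribution P Y) <= b%:E)%E.
Proof.
have dom := change_of_measure_dominates.
rewrite /KL asboolT//.
set r := Radon_Nikodym _ _.
have rfin t : r t \is a fin_num by exact: Radon_Nikodym_fin_num.
have ir : (distribution P Y).-integrable [set: T] r by exact: Radon_Nikodym_integrable.
have mr : measurable_fun [set: T] r by exact: measurable_int ir.
rewrite integral_distributionT; last exact: (measurableT_comp measurable_lne mr).
have mrX : measurable_fun [set: Omega'] (fun w => (r^\+)%E (X w)).
  by apply: (measurableT_comp _ mX); exact: measurable_funepos.
have mrXW : measurable_fun [set: Omega'] (fun w => (r^\+ (X w) * (W w)%:E)%E).
  by apply: emeasurable_funM => //; exact/measurable_EFinP.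
(* The Radon-Nikodym derivative is that of a charge and comes without a sign, so [WXY] is applied to
   its positive part, whose integral is the mass given by the law of [X] to the set where it is
   non-negative. *)
have intr : (\int[P']_w (r^\+ (X w) * (W w)%:E) <= 1)%E.
  apply: le_trans (WXY _ _) _ => //; first exact: measurable_funepos.
  pose A := [set t | (0 <= r t)%E].
  have mA : measurable A.
    by rewrite -[A]setTI; exact: emeasurable_fun_c_infty.
  apply: (@le_trans _ _ (\int[distribution P Y]_t r^\+ t)%E).
    rewrite (@ge0_integral_distribution _ _ _ _ _ P Y)//.
    exact: measurable_funepos.
  rewrite [leLHS](_ : _ = (\int[distribution P Y]_(t in A) r t)%E); last first.
    rewrite [RHS]integral_mkcond; apply: eq_integral => t _.
    rewrite patchE funeposE; have [rt|rt] := leP 0%E (r t).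
      by rewrite ifT// inE.
    by rewrite ifF//; apply/negP; rewrite inE /A/= leNgt rt.
  rewrite -Radon_Nikodym_integral//; exact: probability_le1.
pose N w := ((g w)%:E + r^\+ (X w) * (W w)%:E)%E.
have N0 w : (0 <= N w)%E.
  by rewrite adde_ge0 ?lee_fin// mule_ge0 ?lee_fin// ltW.
have mN : measurable_fun [set: Omega'] N.
  by apply: emeasurable_funD => //; exact/measurable_EFinP.
have intN : (\int[P']_w N w <= (m + b + 1)%:E)%E.
  rewrite /N ge0_integralD//=.
  - by rewrite EFinD leeD.
  - by move=> w _; rewrite lee_fin.
  - exact/measurable_EFinP.
  - by move=> w _; rewrite mule_ge0 ?lee_fin// ltW.
have iN : P'.-integrable [set: Omega'] N.
  apply/integrableP; split => //.
  under eq_integral do rewrite gee0_abs//.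
  exact: le_lt_trans intN (ltry _).
have ic : P'.-integrable [set: Omega'] (EFin \o cst (m + 1)).
  exact: finite_measure_integrable_cst.
apply: (@le_trans _ _ (\int[P']_w (N w - (EFin \o cst (m + 1)%R) w))%E).
  apply: le_integralT.
  - exact: (measurableT_comp (measurableT_comp measurable_lne mr) mX).
  - by apply: emeasurable_funB => //; exact: measurable_int ic.
  - move=> w /=; rewrite /N funeposE.
    (* Where the derivative is not positive, [lne] is -oo and there is nothing to bound. *)
    have [rw0|rw0] := leP (r (X w)) 0%E; first by rewrite le0_lneNy// leNye.
    move: rw0; rewrite -(fineK (rfin (X w))) lte_fin => rw0.
    rewrite lne_EFin// -EFinM -EFinD lee_fin.
    have rW0 : 0 < fine (r (X w)) * W w by exact: mulr_gt0.
    have := @le_ln1Dx R (fine (r (X w)) * W w - 1).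
    rewrite (_ : 1 + (fine (r (X w)) * W w - 1) = fine (r (X w)) * W w); last by ring.
    rewrite lnM ?posrE// => /(_ ltac:(lra)) lnrW.
    have := Wg w; lra.
rewrite integralB// (integral_probability_cst P' (m + 1)%R%:E).
apply: le_trans (leeB intN (le_refl _)) _.
by rewrite -EFinB lee_fin; lra.
Qed.

End KL_change_of_measure.

(** * One-step likelihood ratios *)

Section tilt_theory.
Context {R : realType} {n : nat}.
Implicit Types u v e : 'rV[R]_n.

Lemma tilt_gt0 v u : 0 < tilt v u. Proof. exact: expR_gt0. Qed.

Lemma tilt_ge0 v u : 0 <= tilt v u. Proof. exact: expR_ge0. Qed.

(** The exponent is largest at v = u. The bound is uniform in [v], hence every mixture of tilts is
    finite. *)
Lemma tilt_le v u : tilt v u <= expR (dotv u u / 2).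
Proof.
rewrite /tilt ler_expR; have := dotv_ge0 (u + (- 1) *: v).
by rewrite !(dotvDl, dotvDr, dotvZl, dotvZr) (dotvC v u); lra.
Qed.

Lemma tiltD v v' e : tilt v (v' + e) = expR (dotv v v') * tilt v e.
Proof. by rewrite /tilt dotvDr -expRD addrA. Qed.

Lemma measurable_tilt d (T : measurableType d) (f g : T -> 'rV[R]_n) :
  measurable_fun [set: T] f -> measurable_fun [set: T] g ->
  measurable_fun [set: T] (fun t => tilt (f t) (g t)).
Proof.
move=> mf mg; apply: measurableT_comp => //.
apply: measurable_funB; first exact: measurable_dotv.
by apply: measurable_funM => //; exact: measurable_dotv.
Qed.

(* Controls [ln (tilt v (v + e)) = <v, e> + |v|^2 / 2] by a positive function, since
   [<v, e> <= |v| exp (<v, e> / |v|)]; at [v = 0] the convention [0^-1 = 0] makes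
   the last summand vanish. *)
Definition tilt_cost v e : R :=
  1 + dotv v v / 2 + enorm v * expR (dotv ((enorm v)^-1 *: v) e).

Lemma tilt_cost_ge0 v e : 0 <= tilt_cost v e.
Proof.
by rewrite addr_ge0 ?mulr_ge0 ?enorm_ge0 ?expR_ge0// addr_ge0 ?divr_ge0 ?dotv_ge0.
Qed.

Lemma ln_tilt_le v e : ln (tilt v (v + e)) <= tilt_cost v e - 1.
Proof.
rewrite /tilt expRK dotvDr /tilt_cost dotvZl.
suff : dotv v e <= enorm v * expR ((enorm v)^-1 * dotv v e) by lra.
have [v0|v0] := eqVneq (enorm v) 0.
  have := enorm_sqr v; rewrite v0 expr0n => /esym/dotv_eq0 ->.
  by rewrite dot0v !mul0r.
have vp : 0 < enorm v by rewrite lt_def v0 enorm_ge0.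
rewrite -[leLHS](mulVKf v0) ler_pM2l//.
by have := expR_ge1Dx ((enorm v)^-1 * dotv v e); lra.
Qed.

Lemma measurable_tilt_cost d (T : measurableType d) (f g : T -> 'rV[R]_n) :
  measurable_fun [set: T] f -> measurable_fun [set: T] g ->
  measurable_fun [set: T] (fun t => tilt_cost (f t) (g t)).
Proof.
move=> mf mg; have mn := measurable_enorm mf.
apply: measurable_funD.
  apply: measurable_funD => //; apply: measurable_funM => //.
  exact: measurable_dotv.
apply: measurable_funM => //; apply: measurableT_comp => //.
apply: measurable_dotv => //; apply: measurable_rowZ => //.
exact: (measurableT_comp (@measurable_inv R) mn).
Qed.

Variable gam : probability 'rV[R]_n R.
Hypothesis gamE : gaussian_measure gam.
Local Open Scope ereal_scope.

Lemma integral_tilt v : \int[gam]_e (tilt v e)%:E = 1.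
Proof.
transitivity (\int[gam]_e (cst 1 e * (tilt v e)%:E)).
  by apply: eq_integral => e _; rewrite mul1e.
rewrite -(ge0_integral_gaussian_shift gamE v (psi := cst 1))//.
exact: integral_probability_cst.
Qed.

Lemma integral_expR_gaussian v :
  \int[gam]_e (expR (dotv v e))%:E = (expR (dotv v v / 2))%:E.
Proof.
transitivity (\int[gam]_e (expR (dotv v v / 2) * tilt v e)%:E).
  by apply: eq_integral => e _; rewrite /tilt -expRD; congr ((expR _)%:E); lra.
rewrite ge0_integralZl_real ?expR_ge0//; first by rewrite integral_tilt mule1.
- by apply: measurable_tilt.
- by move=> e; exact: tilt_ge0.
Qed.

(** The unit vector v / |v| has exponential moment exp (1 / 2) <= 2, and 2 |v| <= 1 + |v|^2. *)
Lemma integral_tilt_cost v :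
  \int[gam]_e (tilt_cost v e)%:E <= (2 + 3 / 2 * dotv v v)%:E.
Proof.
have v0 := dotv_ge0 v; have nv0 := enorm_ge0 v; have nvE := enorm_sqr v.
rewrite /tilt_cost; under eq_integral do rewrite EFinD.
rewrite ge0_integralD//=; last 3 first.
- by move=> e _; rewrite lee_fin addr_ge0// divr_ge0.
- by move=> e _; rewrite lee_fin mulr_ge0// expR_ge0.
- apply/measurable_EFinP; apply: measurable_funM => //.
  by apply: measurableT_comp => //; apply: measurable_dotv.
rewrite integral_probability_cst ge0_integralZl_real//; last first.
  by apply: measurableT_comp => //; apply: measurable_dotv.
rewrite integral_expR_gaussian -EFinM -EFinD lee_fin.
have e2 : (expR (2^-1 : R) <= 2)%R.
  have := expR_ge1Dx (- 2^-1 : R); rewrite expRN => h.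
  have p := @expR_gt0 R 2^-1.
  have : (1 / 2 * expR 2^-1 <= (expR 2^-1)^-1 * expR 2^-1 :> R)%R.
    by rewrite ler_pM2r//; lra.
  by rewrite mulVf ?gt_eqF//; lra.
have : (expR (dotv ((enorm v)^-1 *: v) ((enorm v)^-1 *: v) / 2) <= 2)%R.
  apply: le_trans e2; rewrite ler_expR dotvZl dotvZr -nvE.
  have [->|vn0] := eqVneq (enorm v) 0%R; first by rewrite invr0 !mul0r.
  by rewrite expr2 mulKf// mulVf// mul1r.
move=> /(ler_wpM2l nv0); have := sqr_ge0 (enorm v - 1).
by rewrite sqrrB -nvE; lra.
Qed.

End tilt_theory.

(** * Likelihood ratios for a Gaussian with a random shift *)

Section mixture.
Context {R : realType} {n : nat} {dX dU} {X : measurableType dX}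
  {U : measurableType dU}.
Variables (gam : probability 'rV[R]_n R) (rho : probability U R)
  (V : X * U -> 'rV[R]_n).
Hypotheses (gamE : gaussian_measure gam)
  (mV : measurable_fun [set: (X * U)%type] V).
Local Open Scope ereal_scope.

Let mV2 x : measurable_fun [set: U] (fun xi => V (x, xi)).
Proof. by apply: (measurableT_comp mV); exact: measurable_fun_pair. Qed.

(** Density with respect to [gam] of the law of V(x, xi) + e, for xi of law [rho] and e of law [gam]
    independent. *)
Definition mixture (x : X) (u : 'rV[R]_n) : R :=
  fine (\int[rho]_xi (tilt (V (x, xi)) u)%:E).

Lemma mixtureE x u : \int[rho]_xi (tilt (V (x, xi)) u)%:E = (mixture x u)%:E.
Proof.
rewrite /mixture fineK// ge0_fin_numE; last first.
  by apply: integral_ge0 => xi _; rewrite lee_fin tilt_ge0.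
apply: (@le_lt_trans _ _ (\int[rho]_xi (expR (dotv u u / 2))%:E)).
  apply: ge0_le_integral_EFin => //.
  - by apply: measurable_tilt.
  - by move=> xi; exact: tilt_ge0.
  - by move=> xi; exact: tilt_le.
by rewrite integral_probability_cst ltry.
Qed.

Lemma mixture_gt0 x u : (0 < mixture x u)%R.
Proof.
rewrite lt_def; apply/andP; split; last first.
  by rewrite fine_ge0// integral_ge0// => xi _; rewrite lee_fin tilt_ge0.
apply/eqP => h0; have := mixtureE x u; rewrite h0 => int0.
have : (\int[rho]_xi `|(tilt (V (x, xi)) u)%:E| = 0).
  by rewrite -[RHS]int0; apply: eq_integral => xi _; rewrite gee0_abs// lee_fin tilt_ge0.
have mt : measurable_fun [set: U] (fun xi => (tilt (V (x, xi)) u)%:E).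
  by apply/measurable_EFinP; apply: measurable_tilt.
move=> /(ae_eq_integral_abs rho measurableT mt)[N [mN N0 NX]].
have NT : N = setT.
  apply/seteqP; split => // xi _; apply: NX => /= /(_ I) /eqP.
  by rewrite eqe gt_eqF// tilt_gt0.
have : rho setT = 1 by exact: probability_setT.
by rewrite -NT N0 => /eqP; rewrite eqe eq_sym oner_eq0.
Qed.

Lemma measurable_mixture d (T : measurableType d) (f : T -> X)
    (g : T -> 'rV[R]_n) : measurable_fun [set: T] f ->
  measurable_fun [set: T] g ->
  measurable_fun [set: T] (fun t => mixture (f t) (g t)).
Proof.
move=> mf mg; apply: (measurableT_comp (fine_measurable measurableT)) => //.
apply: (@measurable_fun_integral_pair R _ _ _ T (X * 'rV[R]_n)%type U rho
  (fun z => (tilt (V (z.1.1, z.2)) z.1.2)%:E) (fun t => (f t, g t))).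
- apply/measurable_EFinP; apply: measurable_tilt.
    apply: (measurableT_comp mV); apply: measurable_fun_pair => //.
    exact: (measurableT_comp measurable_fst measurable_fst).
  exact: (measurableT_comp measurable_snd measurable_fst).
- by move=> z; rewrite lee_fin tilt_ge0.
- exact: measurable_fun_pair.
Qed.

(** Removing the shift produces the factor [tilt]; its average over the batch is the mixture, which
    cancels the inverse. The identity therefore needs the integral over xi, unlike its analogue for
    a single tilt. *)
Lemma ge0_integral_mixture_shift x (psi : 'rV[R]_n -> \bar R) :
  measurable_fun [set: 'rV[R]_n] psi -> (forall v, 0 <= psi v) ->
  \int[rho]_xi \int[gam]_e
    (psi (V (x, xi) + e)%R * ((mixture x (V (x, xi) + e))^-1)%:E) =
  \int[gam]_e psi e.
Proof.
move=> mpsi psi0.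
pose chi e := psi e * ((mixture x e)^-1)%:E.
have chi0 e : 0 <= chi e.
  by apply: mule_ge0 => //; rewrite lee_fin invr_ge0 ltW// mixture_gt0.
have mchi : measurable_fun [set: 'rV[R]_n] chi.
  apply: emeasurable_funM => //; apply/measurable_EFinP.
  apply: (measurableT_comp (@measurable_inv R)).
  by apply: measurable_mixture.
transitivity (\int[rho]_xi \int[gam]_e (chi e * (tilt (V (x, xi)) e)%:E)).
  by apply: eq_integral => xi _; rewrite -ge0_integral_gaussian_shift.
rewrite (fubini_tonelli (m1 := rho) (m2 := gam)
  (fun z => chi z.2 * (tilt (V (x, z.1)) z.2)%:E)); last 2 first.
- apply: emeasurable_funM; first exact: (measurableT_comp mchi measurable_snd).
  apply/measurable_EFinP; apply: measurable_tilt => //.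
  exact: (measurableT_comp (mV2 x) measurable_fst).
- by move=> z; rewrite mule_ge0// lee_fin tilt_ge0.
apply: eq_integral => e _ /=.
rewrite ge0_integralZl//; last 2 first.
- by apply/measurable_EFinP; apply: measurable_tilt.
- by move=> xi _; rewrite lee_fin tilt_ge0.
rewrite mixtureE /chi -muleA -EFinM mulVf ?mule1//.
by rewrite gt_eqF// mixture_gt0.
Qed.

(** Under the shifted law the mean of the ratio is its second moment under [gam], that is, 1 plus
    the chi-square divergence. The shift turns [tilt] into exp <V', V> times a tilt of integral
    1. *)
Lemma integral_mixture_shift x :
  \int[rho]_xi \int[gam]_e (mixture x (V (x, xi) + e))%:E =
  \int[rho]_xi \int[rho]_xi' (expR (dotv (V (x, xi')) (V (x, xi))))%:E.
Proof.
apply: eq_integral => xi _.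
under eq_integral do rewrite -mixtureE.
rewrite (fubini_tonelli (m1 := gam) (m2 := rho)
  (fun z => (tilt (V (x, z.2)) (V (x, xi) + z.1))%:E)); last 2 first.
- apply/measurable_EFinP; apply: measurable_tilt.
    exact: (measurableT_comp (mV2 x) measurable_snd).
  by apply: measurable_rowD.
- by move=> z; rewrite lee_fin tilt_ge0.
apply: eq_integral => xi' _ /=.
under eq_integral do rewrite tiltD.
rewrite ge0_integralZl_real ?expR_ge0//; first by rewrite integral_tilt// mule1.
- by apply: measurable_tilt.
- by move=> e; exact: tilt_ge0.
Qed.

Lemma ge0_integral_tilt_shift v (psi : 'rV[R]_n -> \bar R) :
  measurable_fun [set: 'rV[R]_n] psi -> (forall v, 0 <= psi v) ->
  \int[gam]_e (psi (v + e)%R * ((tilt v (v + e))^-1)%:E) = \int[gam]_e psi e.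
Proof.
move=> mpsi psi0.
rewrite (ge0_integral_gaussian_shift gamE v
  (psi := fun e => psi e * ((tilt v e)^-1)%:E)).
- apply: eq_integral => e _; rewrite -muleA -EFinM mulVf ?mule1//.
  by rewrite gt_eqF// tilt_gt0.
- apply: emeasurable_funM => //; apply/measurable_EFinP.
  apply: (measurableT_comp (@measurable_inv R)).
  by apply: measurable_tilt.
- by move=> e; rewrite mule_ge0// lee_fin invr_ge0 tilt_ge0.
Qed.

Variable small : X -> bool.
Hypothesis msmall : measurable_fun [set: X] small.

(* Averaging over the batch makes the ratio second order in the size of [V], but
   its chi-square bound needs [V] small; elsewhere the ratio stays conditional on
   the batch. *)
Definition likelihood (x : X) (v u : 'rV[R]_n) : R :=
  if small x then mixture x u else tilt v u.

(** Non-negative and at least 1 plus the logarithm of the ratio at [v + e]: for the mixture by ln y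
    <= y - 1, otherwise by [ln_tilt_le]. *)
Definition likelihood_cost (x : X) (v e : 'rV[R]_n) : R :=
  if small x then mixture x (v + e) else tilt_cost v e.

Lemma likelihood_gt0 x v u : (0 < likelihood x v u)%R.
Proof. by rewrite /likelihood; case: ifP => _; rewrite ?mixture_gt0 ?tilt_gt0. Qed.

Lemma likelihood_cost_ge0 x v e : (0 <= likelihood_cost x v e)%R.
Proof.
rewrite /likelihood_cost; case: ifP => _; last exact: tilt_cost_ge0.
by rewrite ltW// mixture_gt0.
Qed.

Lemma ln_likelihood_le x v e :
  (ln (likelihood x v (v + e)) <= likelihood_cost x v e - 1)%R.
Proof.
rewrite /likelihood /likelihood_cost; case: ifP => _; last exact: ln_tilt_le.
have p := mixture_gt0 x (v + e).
have := @le_ln1Dx R (mixture x (v + e) - 1).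
rewrite (_ : 1 + (mixture x (v + e) - 1) = mixture x (v + e))%R; last by ring.
by apply; lra.
Qed.

Lemma measurable_likelihood d (T : measurableType d) (f : T -> X)
    (g h : T -> 'rV[R]_n) : measurable_fun [set: T] f ->
  measurable_fun [set: T] g -> measurable_fun [set: T] h ->
  measurable_fun [set: T] (fun t => likelihood (f t) (g t) (h t)).
Proof.
move=> mf mg mh; apply: measurable_fun_ifT.
- exact: (measurableT_comp msmall mf).
- exact: measurable_mixture.
- exact: measurable_tilt.
Qed.

Lemma measurable_likelihood_cost d (T : measurableType d) (f : T -> X)
    (g h : T -> 'rV[R]_n) : measurable_fun [set: T] f ->
  measurable_fun [set: T] g -> measurable_fun [set: T] h ->
  measurable_fun [set: T] (fun t => likelihood_cost (f t) (g t) (h t)).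
Proof.
move=> mf mg mh; apply: measurable_fun_ifT.
- exact: (measurableT_comp msmall mf).
- by apply: measurable_mixture => //; exact: measurable_rowD.
- exact: measurable_tilt_cost.
Qed.

Lemma ge0_integral_likelihood_shift x (psi : 'rV[R]_n -> \bar R) :
  measurable_fun [set: 'rV[R]_n] psi -> (forall v, 0 <= psi v) ->
  \int[rho]_xi \int[gam]_e (psi (V (x, xi) + e)%R *
    ((likelihood x (V (x, xi)) (V (x, xi) + e))^-1)%:E) =
  \int[gam]_e psi e.
Proof.
move=> mpsi psi0; rewrite /likelihood; case: (small x).
  exact: ge0_integral_mixture_shift.
transitivity (\int[rho]_xi \int[gam]_e psi e).
  by apply: eq_integral => xi _; exact: ge0_integral_tilt_shift.
exact: integral_probability_cst.
Qed.

Lemma integral_likelihood_cost x (a : R) : (0 <= a)%R ->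
  small x = (32 * a ^+ 2 <= 1)%R ->
  (small x -> \int[rho]_xi \int[rho]_xi' (expR (dotv (V (x, xi')) (V (x, xi))))%:E
     <= (expR (4 * a ^+ 2))%:E) ->
  (~~ small x -> \int[rho]_xi (dotv (V (x, xi)) (V (x, xi)))%:E <= (32 * a)%:E) ->
  \int[rho]_xi \int[gam]_e (likelihood_cost x (V (x, xi)) e)%:E <=
  (1 + 320 * a ^+ 2)%:E.
Proof.
move=> a0; rewrite /likelihood_cost.
case: (small x) => [smallE Hs _|smallE _ /(_ isT) Hl]; last first.
  have a2 : (1 < 32 * a ^+ 2)%R by rewrite ltNge -smallE.
  apply: (@le_trans _ _ (\int[rho]_xi (2 + 3 / 2 * dotv (V (x, xi)) (V (x, xi)))%:E)).
    apply: ge0_le_integral => //.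
    - by move=> xi _; apply: integral_ge0 => e _; rewrite lee_fin tilt_cost_ge0.
    - apply: (@measurable_fun_integral_pair R _ _ _ U U _ gam
        (fun z => (tilt_cost (V (x, z.1)) z.2)%:E) id) => //.
        apply/measurable_EFinP; apply: measurable_tilt_cost => //.
        exact: (measurableT_comp (mV2 x) measurable_fst).
      by move=> z; rewrite lee_fin tilt_cost_ge0.
    - apply/measurable_EFinP; apply: measurable_funD => //.
      by apply: measurable_funM => //; exact: measurable_dotv.
    - by move=> xi _; exact: integral_tilt_cost.
  under eq_integral do rewrite EFinD.
  rewrite ge0_integralD//=; last 2 first.
  - by move=> xi _; rewrite lee_fin mulr_ge0 ?dotv_ge0// divr_ge0.
  - apply/measurable_EFinP; apply: measurable_funM => //.
    exact: measurable_dotv.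
  rewrite integral_probability_cst ge0_integralZl_real//; last 2 first.
  - exact: measurable_dotv.
  - by move=> xi; exact: dotv_ge0.
  apply: (@le_trans _ _ (2%:E + (3 / 2)%:E * (32 * a)%:E)).
    by rewrite leeD2l// lee_wpmul2l// lee_fin divr_ge0.
  (* Origin of 320: when 32 a^2 > 1, 2 + 48 a <= 1 + 320 a^2; at the threshold the sides are about
     10.5 and 11. *)
  by rewrite -EFinM -EFinD lee_fin; nra.
rewrite integral_mixture_shift; apply: le_trans (Hs isT) _.
have a2 : (32 * a ^+ 2 <= 1)%R by rewrite -smallE.
(* Here 4 a^2 <= 1 / 8, and the quadratic bound gives 1 + 4 a^2 + 32 a^4 <= 1 + 5 a^2. *)
rewrite lee_fin; apply: le_trans (expR_le_quadratic _) _; first by nra.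
by nra.
Qed.

End mixture.

(** * Comparison of two chains *)

Section sigma_RV_theory.
Context {R : realType} {d d'} {Omega : measurableType d} {T : measurableType d'}
  {P : probability Omega R}.
Variable X : {RV P >-> T}.

Lemma sigma_RV_measurable : sigma_RV X `<=` measurable.
Proof. by move=> _ [B mB <-]; exact: (measurable_funP X). Qed.

Lemma sigma_RVT : sigma_RV X setT.
Proof. by exists setT => //; rewrite preimage_setT setTI. Qed.

Lemma sigma_RV_setI : setI_closed (sigma_RV X).
Proof.
move=> _ _ [B mB <-] [C mC <-]; exists (B `&` C); first exact: measurableI.
by rewrite preimage_setI !setTI.
Qed.

End sigma_RV_theory.

Section adapted_theory.
Context {d} {Omega : measurableType d}.
Variable G : set_system Omega.

Lemma adapted_cst d' (T : measurableType d') (t : T) :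
  adapted G (fun _ : Omega => t).
Proof. exact: measurable_cst. Qed.

Lemma adapted_comp d1 d2 (T1 : measurableType d1) (T2 : measurableType d2)
    (X : Omega -> T1) (h : T1 -> T2) :
  measurable_fun [set: T1] h -> adapted G X -> adapted G (h \o X).
Proof. by move=> mh mX; exact: (measurableT_comp mh mX). Qed.

Lemma adapted_pair d1 d2 (T1 : measurableType d1) (T2 : measurableType d2)
    (X : Omega -> T1) (Y : Omega -> T2) :
  adapted G X -> adapted G Y -> adapted G (fun w => (X w, Y w)).
Proof. by move=> mX mY; exact: measurable_fun_pair. Qed.

Lemma adapted_tuple d1 (T1 : measurableType d1) n
    (X : 'I_n -> Omega -> T1) : (forall i, adapted G (X i)) ->
  adapted G (fun w => [tuple X i w | i < n]).
Proof.
move=> mX; apply/measurable_fun_tnthP => i.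
rewrite (_ : _ \o _ = X i); first exact: mX.
by apply/funext => w /=; rewrite tnth_mktuple.
Qed.

Lemma adapted_measurable d1 (T1 : measurableType d1) (X : Omega -> T1) :
  <<s G >> `<=` measurable -> adapted G X -> measurable_fun [set: Omega] X.
Proof. by move=> Gm /adaptedP mX _ A mA; rewrite setTI; apply: Gm; exact: mX. Qed.

Lemma adapted_row_sum (R : realType) n (I : Type) (r : seq I) (Q : pred I)
    (X : I -> Omega -> 'rV[R]_n) : (forall i, Q i -> adapted G (X i)) ->
  adapted G (fun w => \sum_(i <- r | Q i) X i w).
Proof.
move=> mX; rewrite /adapted.
have -> : (fun w : g_sigma_algebraType G => \sum_(i <- r | Q i) X i w) =
    (fun w : g_sigma_algebraType G => \sum_(i <- r) (if Q i then X i w else 0)).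
  by apply/funext => w; rewrite big_mkcond.
apply: measurable_row_sum => i.
by case: (boolP (Q i)) => Qi; [exact: mX|exact: measurable_cst].
Qed.

End adapted_theory.

Section independent_family.
Context {R : realType} {disp} {Omega : measurableType disp}
  (P : probability Omega R) {I : eqType} (E : I -> set_system Omega).
Hypotheses (Em : forall i, E i `<=` measurable) (ET : forall i, E i setT)
  (EI : forall i, setI_closed (E i)) (indepE : mutually_independent P E).

Lemma adapted_sigma_RV d (T : measurableType d) (X : {RV P >-> T}) (Q : pred I) i :
  Q i -> E i = sigma_RV X -> adapted (finI_system E Q) X.
Proof.
move=> Qi Ei; apply/adaptedP => A mA; apply: sub_sigma_algebra.
by apply: (finI_system1 Qi); rewrite Ei; exists A => //; rewrite setTI.
Qed.

Lemma ge0_integral_indep_adapted d1 d2 (T1 : measurableType d1)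
    (T2 : measurableType d2) (Q Q' : pred I) (X : Omega -> T1)
    (Z : Omega -> T2) (nu : probability T2 R) (phi : T1 * T2 -> \bar R) :
  (forall i, Q i -> ~~ Q' i) ->
  adapted (finI_system E Q) X -> adapted (finI_system E Q') Z ->
  (forall A, measurable A -> P (Z @^-1` A) = nu A) ->
  measurable_fun [set: (T1 * T2)%type] phi -> (forall u, (0 <= phi u)%E) ->
  (\int[P]_w phi (X w, Z w) = \int[P]_w \int[nu]_z phi (X w, z))%E.
Proof.
move=> QQ' aX aZ Zlaw; apply: ge0_integral_indep.
- by apply: adapted_measurable aX; exact: sigma_finI_measurable.
- by apply: adapted_measurable aZ; exact: sigma_finI_measurable.
- move=> A B mA mB; rewrite -Zlaw//; apply: (sigma_finI_indep Em ET EI indepE QQ').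
  + by move/adaptedP: aX; exact.
  + by move/adaptedP: aZ; exact.
Qed.

End independent_family.

(** * Change of measure along a chain *)

Section chain.
Context {R : realType} {n : nat} {dT dU d d'} {T : measurableType dT}
  {U : measurableType dU} {Omega : measurableType d}
  {Omega' : measurableType d'}.
Variables (gam : probability 'rV[R]_n R) (rho : probability U R)
  (V : T * U -> 'rV[R]_n) (small : T -> bool)
  (step : nat -> T * 'rV[R]_n -> T).
Hypotheses (gamE : gaussian_measure gam)
  (mV : measurable_fun [set: (T * U)%type] V)
  (msmall : measurable_fun [set: T] small)
  (mstep : forall k, measurable_fun [set: (T * 'rV[R]_n)%type] (step k)).
Variables (P : probability Omega R) (s : nat -> Omega -> T)
  (eps : nat -> Omega -> 'rV[R]_n).
Hypotheses (ms : forall k, measurable_fun [set: Omega] (s k))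
  (sS : forall k w, s k.+1 w = step k (s k w, eps k w))
  (s_indep : forall k (phi : T * 'rV[R]_n -> \bar R),
    measurable_fun [set: (T * 'rV[R]_n)%type] phi -> (forall u, (0 <= phi u)%E) ->
    (\int[P]_w phi (s k w, eps k w) = \int[P]_w \int[gam]_e phi (s k w, e))%E).
Variables (P' : probability Omega' R) (s' : nat -> Omega' -> T)
  (eps' : nat -> Omega' -> 'rV[R]_n) (xi : nat -> Omega' -> U).

Definition noise k w := V (s' k w, xi k w).

Definition weight k w : R :=
  \prod_(j < k) (likelihood rho V small (s' j w) (noise j w) (noise j w + eps' j w))^-1.

Hypotheses (ms' : forall k, measurable_fun [set: Omega'] (s' k))
  (meps' : forall k, measurable_fun [set: Omega'] (eps' k))
  (mxi : forall k, measurable_fun [set: Omega'] (xi k))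
  (s'S : forall k w, s' k.+1 w = step k (s' k w, noise k w + eps' k w))
  (s'_indep : forall k (phi : (T * R) * U * 'rV[R]_n -> \bar R),
    measurable_fun [set: ((T * R) * U * 'rV[R]_n)%type] phi ->
    (forall u, (0 <= phi u)%E) ->
    (\int[P']_w phi (((s' k w, weight k w), xi k w), eps' k w) =
     \int[P']_w \int[rho]_u \int[gam]_e phi (((s' k w, weight k w), u), e))%E)
  (s0_law : forall phi : T -> \bar R, measurable_fun [set: T] phi ->
    (forall t, (0 <= phi t)%E) ->
    (\int[P']_w phi (s' 0%N w) = \int[P]_w phi (s 0%N w))%E).

Lemma weight_gt0 k w : 0 < weight k w.
Proof. by apply: prodr_gt0 => j _; rewrite invr_gt0; exact: likelihood_gt0. Qed.

Lemma measurable_noise k : measurable_fun [set: Omega'] (noise k).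
Proof. by apply: (measurableT_comp mV); exact: measurable_fun_pair. Qed.

Lemma measurable_weight k : measurable_fun [set: Omega'] (weight k).
Proof.
apply: measurable_prod => j _; apply: (measurableT_comp measurable_inv).
apply: measurable_likelihood => //; first exact: measurable_noise.
by apply: measurable_rowD => //; exact: measurable_noise.
Qed.

(** Freezing the pair of state and weight, the integral over the current batch and Gaussian turns
    the noisy step, weighted by its inverse ratio, into a purely Gaussian step. The induction then
    moves to the other chain. The weight is frozen with the state because it is not a function of
    the state. *)
Lemma integral_chain_weight k (phi : T -> \bar R) :
  measurable_fun [set: T] phi -> (forall t, (0 <= phi t)%E) ->
  (\int[P']_w (phi (s' k w) * (weight k w)%:E) = \int[P]_w phi (s k w))%E.
Proof.
elim: k phi => [|k IH] phi mphi phi0.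
  rewrite -s0_law//; apply: eq_integral => w _.
  by rewrite /weight big_ord0 mule1.
pose vu (z : (T * R) * U * 'rV[R]_n) := V (z.1.1.1, z.1.2).
have mvu : measurable_fun [set: ((T * R) * U * 'rV[R]_n)%type] vu.
  apply: (measurableT_comp mV); apply: measurable_fun_pair.
    exact: (measurableT_comp measurable_fst (measurableT_comp measurable_fst measurable_fst)).
  exact: (measurableT_comp measurable_snd measurable_fst).
have mst : measurable_fun [set: ((T * R) * U * 'rV[R]_n)%type] (fun z => z.1.1.1).
  exact: (measurableT_comp measurable_fst (measurableT_comp measurable_fst measurable_fst)).
have mwt : measurable_fun [set: ((T * R) * U * 'rV[R]_n)%type] (fun z => z.1.1.2).
  exact: (measurableT_comp measurable_snd (measurableT_comp measurable_fst measurable_fst)).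
have mvuD : measurable_fun [set: ((T * R) * U * 'rV[R]_n)%type] (fun z => vu z + z.2).
  exact: measurable_rowD.
(* The slot of the weight ranges over all reals; the absolute value keeps [Phi] non-negative
   everywhere and is harmless on actual weights. *)
pose Phi (z : (T * R) * U * 'rV[R]_n) :=
  (phi (step k (z.1.1.1, vu z + z.2)%R) *
   (`|z.1.1.2| * (likelihood rho V small z.1.1.1 (vu z) (vu z + z.2))^-1)%R%:E)%E.
have Phi0 z : (0 <= Phi z)%E.
  rewrite mule_ge0// lee_fin mulr_ge0// invr_ge0 ltW//; exact: likelihood_gt0.
have mPhi : measurable_fun [set: ((T * R) * U * 'rV[R]_n)%type] Phi.
  apply: emeasurable_funM.
    apply: (measurableT_comp mphi); apply: (measurableT_comp (mstep k)).
    exact: measurable_fun_pair.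
  apply/measurable_EFinP; apply: measurable_funM; first exact: measurableT_comp.
  apply: (measurableT_comp measurable_inv).
  exact: measurable_likelihood.
transitivity (\int[P']_w Phi (((s' k w, weight k w), xi k w), eps' k w))%E.
  apply: eq_integral => w _; rewrite s'S /weight big_ord_recr/= -/(weight k w).
  by rewrite /Phi/= ger0_norm// ltW// weight_gt0.
rewrite s'_indep//.
pose psi t := (\int[gam]_e phi (step k (t, e)))%E.
have mphis : measurable_fun [set: (T * 'rV[R]_n)%type] (fun z => phi (step k z)).
  exact: (measurableT_comp mphi (mstep k)).
have mpsi : measurable_fun [set: T] psi.
  exact: (@measurable_fun_integral_pair R _ _ _ T T _ gam (fun z => phi (step k z)) id).
have psi0 t : (0 <= psi t)%E by exact: integral_ge0.
transitivity (\int[P']_w (psi (s' k w) * (weight k w)%:E))%E; last first.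
  rewrite IH// /psi -(@s_indep k (fun z => phi (step k z)))//.
  by apply: eq_integral => w _; rewrite sS.
apply: eq_integral => w _.
have mstepk : measurable_fun [set: 'rV[R]_n] (fun e => phi (step k (s' k w, e))).
  apply: (measurableT_comp mphi); apply: (measurableT_comp (mstep k)).
  exact: measurable_fun_pair.
rewrite muleC /psi -(ge0_integral_likelihood_shift rho gamE mV small (s' k w) mstepk)//.
pose chi (z : U * 'rV[R]_n) := (phi (step k (s' k w, V (s' k w, z.1) + z.2)%R) *
  ((likelihood rho V small (s' k w) (V (s' k w, z.1)) (V (s' k w, z.1) + z.2))^-1)%R%:E)%E.
have chi0 z : (0 <= chi z)%E.
  by rewrite mule_ge0// lee_fin invr_ge0 ltW//; exact: likelihood_gt0.
have mV' : measurable_fun [set: (U * 'rV[R]_n)%type] (fun z => V (s' k w, z.1)).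
  by apply: (measurableT_comp mV); exact: measurable_fun_pair.
have mV'D : measurable_fun [set: (U * 'rV[R]_n)%type] (fun z => V (s' k w, z.1) + z.2).
  exact: measurable_rowD.
have mchi : measurable_fun [set: (U * 'rV[R]_n)%type] chi.
  apply: emeasurable_funM; first exact: (measurableT_comp mstepk mV'D).
  apply/measurable_EFinP; apply: (measurableT_comp measurable_inv).
  exact: measurable_likelihood.
have mchiu u : measurable_fun [set: 'rV[R]_n] (fun e => chi (u, e)).
  by apply: (measurableT_comp mchi); exact: measurable_fun_pair.
have w0 : 0 <= weight k w by rewrite ltW// weight_gt0.
rewrite -ge0_integralZl_EFin//; last 2 first.
- by move=> u _; apply: integral_ge0 => e _; exact: (chi0 (u, e)).
- exact: (@measurable_fun_integral_pair R _ _ _ U U _ gam chi id).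
apply: eq_integral => u _; rewrite -ge0_integralZl_EFin//; last 2 first.
- by move=> e _; exact: (chi0 (u, e)).
- exact: (mchiu u).
apply: eq_integral => e _; rewrite /Phi /vu/= ger0_norm// EFinM.
by rewrite muleCA muleA.
Qed.

Variable a : T -> R.
Hypotheses (ma : measurable_fun [set: T] a) (a0 : forall t, 0 <= a t)
  (smallE : forall t, small t = (32 * a t ^+ 2 <= 1))
  (exp_noise : forall t, small t ->
    (\int[rho]_u \int[rho]_u' (expR (dotv (V (t, u')) (V (t, u))))%:E
     <= (expR (4 * a t ^+ 2))%:E)%E)
  (sqr_noise : forall t, ~~ small t ->
    (\int[rho]_u (dotv (V (t, u)) (V (t, u)))%:E <= (32 * a t)%:E)%E).

Definition cost k w : R :=
  likelihood_cost rho V small (s' k w) (noise k w) (eps' k w).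

Lemma measurable_cost k : measurable_fun [set: Omega'] (cost k).
Proof. by apply: measurable_likelihood_cost => //; exact: measurable_noise. Qed.

Lemma integral_cost k :
  (\int[P']_w (cost k w)%:E <= 1%:E + \int[P']_w (320 * a (s' k w) ^+ 2)%R%:E)%E.
Proof.
pose phi (z : (T * R) * U * 'rV[R]_n) :=
  (likelihood_cost rho V small z.1.1.1 (V (z.1.1.1, z.1.2)) z.2)%:E.
have phi0 z : (0 <= phi z)%E by rewrite lee_fin likelihood_cost_ge0.
have mst : measurable_fun [set: ((T * R) * U * 'rV[R]_n)%type] (fun z => z.1.1.1).
  exact: (measurableT_comp measurable_fst (measurableT_comp measurable_fst measurable_fst)).
have mphi : measurable_fun [set: ((T * R) * U * 'rV[R]_n)%type] phi.
  apply/measurable_EFinP; apply: measurable_likelihood_cost => //.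
  apply: (measurableT_comp mV); apply: measurable_fun_pair => //.
  exact: (measurableT_comp measurable_snd measurable_fst).
rewrite [leLHS](@s'_indep k phi)//.
have ma2 : measurable_fun [set: Omega'] (fun w => 320 * a (s' k w) ^+ 2).
  apply: measurable_funM => //; apply: measurable_funX.
  exact: (measurableT_comp ma).
have a2_ge0 w : 0 <= 320 * a (s' k w) ^+ 2.
  by apply: mulr_ge0; [exact: ler0n|exact: sqr_ge0].
have -> : (1%:E + \int[P']_w (320 * a (s' k w) ^+ 2)%R%:E =
    \int[P']_w (1%:E + (320 * a (s' k w) ^+ 2)%R%:E))%E.
  rewrite ge0_integralD; [by rewrite integral_probability_cst|exact: measurableT|
    by move=> w _; rewrite lee_fin ler01|exact: measurable_cst|
    by move=> w _; rewrite lee_fin|exact/measurable_EFinP].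
have mphi2 : measurable_fun [set: ((T * R) * U)%type]
    (fun z => \int[gam]_e phi (z, e))%E.
  exact: (@measurable_fun_integral_pair R _ _ _ _ _ _ gam phi id).
apply: ge0_le_integral => //.
- by move=> w _; apply: integral_ge0 => u _; apply: integral_ge0.
- apply: (@measurable_fun_integral_pair R _ _ _ _ _ _ rho
    (fun z : (T * R) * U => \int[gam]_e phi (z, e))%E (fun w => (s' k w, weight k w))) => //.
    by move=> z; apply: integral_ge0.
  by apply: measurable_fun_pair => //; exact: measurable_weight.
- apply: emeasurable_funD => //; exact/measurable_EFinP.
- by move=> w _; apply: integral_likelihood_cost => //; [exact: exp_noise|exact: sqr_noise].
Qed.

(** Each factor contributes its cost minus 1. The total k is the constant [m] of [KL_le], and it
    offsets the 1 in each bound on an expected cost. *)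
Lemma ln_weight_le k w : - ln (weight k w) <= \sum_(j < k) cost j w - k%:R.
Proof.
elim: k => [|k IH]; first by rewrite /weight !big_ord0 ln1 subr0 oppr0.
rewrite /weight big_ord_recr/= -/(weight k w) big_ord_recr/= -natr1.
have lp := likelihood_gt0 rho mV small (s' k w) (noise k w) (noise k w + eps' k w).
rewrite lnM ?posrE ?weight_gt0 ?invr_gt0// lnV ?posrE//.
have := ln_likelihood_le rho mV small (s' k w) (noise k w) (eps' k w).
by rewrite -/(cost k w); lra.
Qed.

Variables (dO : measure_display) (O : measurableType dO) (out : T -> O) (K : nat)
  (Y : {RV P >-> O}) (Y' : {RV P' >-> O}) (c : R).
Hypotheses (mout : measurable_fun [set: T] out)
  (YE : forall w, Y w = out (s K w)) (Y'E : forall w, Y' w = out (s' K w))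
  (c_bound : forall k, (k < K)%N ->
    (\int[P']_w (320 * a (s' k w) ^+ 2)%R%:E <= c%:E)%E).

(** The weighted identity, applied to [phi \o out], compares the laws of any measurable function of
    the last state. *)
Lemma KL_chain_le :
  (KL (distribution P' Y') (distribution P Y) <= (K%:R * c)%:E)%E.
Proof.
apply: (@KL_le _ _ _ _ _ _ _ _ _ Y Y' (weight K) (fun w => \sum_(j < K) cost j w) K%:R).
- exact: measurable_weight.
- exact: weight_gt0.
- move=> phi mphi phi0.
  have := integral_chain_weight K (measurableT_comp mphi mout) (fun t => phi0 _).
  move=> /= H; rewrite le_eqVlt; apply/orP; left; apply/eqP.
  by under eq_integral do rewrite Y'E; rewrite H; apply: eq_integral => w _; rewrite YE.
- by apply: measurable_sum => j; exact: measurable_cost.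
- by move=> w; apply: sumr_ge0 => j _; exact: likelihood_cost_ge0.
- exact: ln_weight_le.
under eq_integral do rewrite -sumEFin.
rewrite ge0_integral_sum//; last 2 first.
- by move=> j; apply/measurable_EFinP; exact: measurable_cost.
- by move=> j w _; rewrite lee_fin; exact: likelihood_cost_ge0.
apply: (@le_trans _ _ (\sum_(j < K) (1 + c)%:E)%E).
  apply: lee_sum => j _; apply: le_trans (integral_cost j) _.
  by rewrite EFinD leeD2l// c_bound.
rewrite sumEFin lee_fin sumr_const card_ord -[leLHS]mulr_natl.
by rewrite le_eqVlt; apply/orP; left; apply/eqP; ring.
Qed.

End chain.

(** * The stochastic gradient noise *)

Section gradient_noise.
Context {R : realType} {d : nat} {dXi} {Xi : measurableType dXi}.
Variables (PXi : probability Xi R) (f : 'rV[R]_d -> Xi -> R)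
  (F : 'rV[R]_d -> R) (M G : R).
Hypotheses (unb : unbiased_gradient PXi f F) (M0 : 0 <= M) (G0 : 0 <= G)
  (grow : linear_growth f F M G).

Lemma measurable_sgrad_coord i : measurable_fun [set: ('rV[R]_d * Xi)%type]
  (fun u => grad (f ^~ u.2) u.1 ord0 i).
Proof. by case: unb => _ /measurable_fun_rVP + _; apply. Qed.

(** Measurability of grad F comes from its being the mean of a jointly measurable stochastic
    gradient. *)
Lemma measurable_grad : measurable_fun [set: 'rV[R]_d] (grad F).
Proof.
case: (unb) => _ _ EF; apply/measurable_fun_rVP => i.
have mg := measurable_sgrad_coord i.
(* Parametric integrals are known to be measurable for non-negative integrands, hence the split into
   positive and negative parts. *)
have -> : (fun x => grad F x ord0 i) = (fun x => fine
    (\int[PXi]_z maxe (grad (f ^~ z) x ord0 i)%:E 0 -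
     \int[PXi]_z maxe (- (grad (f ^~ z) x ord0 i)%:E) 0)%E).
  apply/funext => x; rewrite -[LHS]/(fine (grad F x ord0 i)%:E) -EF unlock.
  rewrite integralE; congr (fine (_ - _)%E).
    by apply: eq_integral => z _; rewrite funeposE.
  by apply: eq_integral => z _; rewrite funenegE.
apply: (measurableT_comp (fine_measurable measurableT)) => //.
apply: emeasurable_funB.
- apply: (@measurable_fun_integral_pair R _ _ _ _ _ _ PXi
    (fun u => maxe (grad (f ^~ u.2) u.1 ord0 i)%:E 0)%E id) => //.
    by apply: measurable_maxe => //; exact/measurable_EFinP.
  by move=> u; rewrite le_max lexx orbT.
- apply: (@measurable_fun_integral_pair R _ _ _ _ _ _ PXi
    (fun u => maxe (- (grad (f ^~ u.2) u.1 ord0 i)%:E) 0)%E id) => //.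
    apply: measurable_maxe => //; apply: measurableT_comp => //.
    exact/measurable_EFinP.
  by move=> u; rewrite le_max lexx orbT.
Qed.

Definition gnoise (x : 'rV[R]_d) (z : Xi) : 'rV[R]_d :=
  grad (f ^~ z) x - grad F x.

Lemma measurable_gnoise dT (T : measurableType dT) (X : T -> 'rV[R]_d)
    (Z : T -> Xi) : measurable_fun [set: T] X -> measurable_fun [set: T] Z ->
  measurable_fun [set: T] (fun t => gnoise (X t) (Z t)).
Proof.
move=> mX mZ; apply: measurable_rowD.
  case: unb => _ mg _.
  exact: (measurableT_comp mg (measurable_fun_pair mX mZ)).
by apply: measurable_rowN; exact: (measurableT_comp measurable_grad mX).
Qed.

Definition noise_radius (x : 'rV[R]_d) : R := M * enorm x + G.

Lemma noise_radius_ge0 x : 0 <= noise_radius x.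
Proof. by rewrite addr_ge0// mulr_ge0// enorm_ge0. Qed.

(** The noise at fixed [x] is bounded, hence integrable, so grad f can be integrated as noise plus
    the constant grad F and the finite constant cancelled. *)
Lemma gnoise_centered x i : (\int[PXi]_z (gnoise x z ord0 i)%:E = 0)%E.
Proof.
have mz : measurable_fun [set: Xi] (gnoise x) by exact: measurable_gnoise.
have iz : PXi.-integrable [set: Xi] (fun z => (gnoise x z ord0 i)%:E).
  exact: (integrable_bounded_coord _ mz (noise_radius_ge0 x) (grow x)).
have ic : PXi.-integrable [set: Xi] (EFin \o cst (grad F x ord0 i)).
  exact: finite_measure_integrable_cst.
case: (unb) => _ _ /(_ x i); rewrite unlock => EF.
have fin : (\int[PXi]_z (gnoise x z ord0 i)%:E)%E \is a fin_num.
  exact: integrable_fin_num.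
have : (\int[PXi]_z (gnoise x z ord0 i)%:E + (grad F x ord0 i)%:E =
    (grad F x ord0 i)%:E)%E.
  rewrite -[in RHS]EF -{1}(integral_probability_cst PXi (grad F x ord0 i)%:E).
  rewrite -[LHS](integralD measurableT iz ic); apply: eq_integral => z _.
  by rewrite /= -EFinD !mxE subrK.
by rewrite -(fineK fin) => -[] /(canRL (addrK _)); rewrite subrr => ->.
Qed.

Context {dO} {Omega : measurableType dO} (P : probability Omega R)
  {I : eqType} (E : I -> set_system Omega).
Hypotheses (Em : forall i, E i `<=` measurable) (ET : forall i, E i setT)
  (EI : forall i, setI_closed (E i)) (indepE : mutually_independent P E).
Variables (B : nat) (xi : 'I_B -> {RV P >-> Xi}) (idx : 'I_B -> I).
Hypotheses (B0 : (0 < B)%N) (idx_inj : injective idx)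
  (EidxE : forall i, E (idx i) = sigma_RV (xi i))
  (xi_law : forall i, eq_law (distribution P (xi i)) PXi).

Let i0 : 'I_B := Ordinal B0.

(** Partial sums over natural numbers, to match the recursion used for bounded centered vectors;
    [insubd] returns the default [i0] only from index [B] on. *)
Let S (x : 'rV[R]_d) (k : nat) (w : Omega) : 'rV[R]_d :=
  \sum_(0 <= j < k) gnoise x (xi (insubd i0 j) w).

Let S_B x w : S x B w = \sum_(i < B) gnoise x (xi i w).
Proof.
rewrite /S big_mkord; apply: eq_bigr => i _.
by rewrite valKd.
Qed.

Let mS x k : measurable_fun [set: Omega] (S x k).
Proof. by apply: measurable_row_sum => j; exact: measurable_gnoise. Qed.

Let S_indep x k (phi : 'rV[R]_d * Xi -> \bar R) : (k < B)%N ->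
  measurable_fun [set: ('rV[R]_d * Xi)%type] phi -> (forall u, (0 <= phi u)%E) ->
  (\int[P]_w phi (S x k w, xi (insubd i0 k) w) =
   \int[P]_w \int[PXi]_z phi (S x k w, z))%E.
Proof.
(* The sources of the first [k] summands; injectivity of [idx] keeps the next source out of [Q]. *)
move=> kB; pose Q j := [exists i : 'I_B, (i < k)%N && (j == idx i)].
apply: (ge0_integral_indep_adapted Em ET EI indepE (Q := Q)
  (Q' := pred1 (idx (insubd i0 k)))).
- move=> j /existsP[i /andP[ik /eqP ->]] /=; apply/eqP => /idx_inj ii.
  by move: ik; rewrite ii insubdK ?inE// ltnn.
- have -> : S x k = fun w => \sum_(i < k) gnoise x (xi (insubd i0 i) w).
    by apply/funext => w; rewrite /S big_mkord.
  apply: adapted_row_sum => i _.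
  apply: (adapted_comp (h := gnoise x)); first exact: measurable_gnoise.
  apply: (adapted_sigma_RV (i := idx (insubd i0 i))) => //.
  apply/existsP; exists (insubd i0 i); rewrite eqxx andbT insubdK//.
  exact: (ltn_trans (ltn_ord i) kB).
- by apply: (adapted_sigma_RV (i := idx (insubd i0 k))) => //=.
- by move=> A mA; rewrite -(xi_law (insubd i0 k) mA).
Qed.

Let mg x : measurable_fun [set: Xi] (gnoise x).
Proof. exact: measurable_gnoise. Qed.

Let mxi (k : nat) : measurable_fun [set: Omega] (xi (insubd i0 k)).
Proof. by []. Qed.

Let S_0 x w : S x 0 w = 0. Proof. by rewrite /S big_geq. Qed.

Let S_S x k w : (k < B)%N -> S x k.+1 w = S x k w + gnoise x (xi (insubd i0 k) w).
Proof. by move=> _; rewrite /S big_nat_recr. Qed.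

Lemma integral_expR_dotv_noise x (theta : 'rV[R]_d) :
  (\int[P]_w (expR (dotv theta (\sum_(i < B) gnoise x (xi i w))))%:E <=
   (expR (2 * B%:R * noise_radius x ^+ 2 * dotv theta theta))%:E)%E.
Proof.
under eq_integral do rewrite -S_B.
exact: (integral_expR_dotv_sum (mg x) (noise_radius_ge0 x) (grow x)
  (gnoise_centered x) (mS x) (S_0 x) (S_S x) (S_indep x)).
Qed.

Lemma integral_expR_sqr_noise x (s : R) : 0 <= s ->
  16 * s * B%:R * noise_radius x ^+ 2 <= 1 ->
  (\int[P]_w (expR (s * dotv (\sum_(i < B) gnoise x (xi i w))
                        (\sum_(i < B) gnoise x (xi i w))))%:E <=
   (expR (2 * s * B%:R * noise_radius x ^+ 2))%:E)%E.
Proof.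
move=> s0 sB; under eq_integral do rewrite -S_B.
exact: (integral_expR_sqr_sum (mg x) (noise_radius_ge0 x) (grow x)
  (gnoise_centered x) (mS x) mxi (S_0 x) (S_S x) (S_indep x)).
Qed.

Variable kap : R.

Definition batch_noise (x : 'rV[R]_d) (u : B.-tuple Xi) : 'rV[R]_d :=
  kap *: \sum_(i < B) gnoise x (tnth u i).

Lemma measurable_batch_noise dT (T : measurableType dT) (X : T -> 'rV[R]_d)
    (u : T -> B.-tuple Xi) : measurable_fun [set: T] X ->
  measurable_fun [set: T] u ->
  measurable_fun [set: T] (fun t => batch_noise (X t) (u t)).
Proof.
move=> mX mu; apply: measurable_rowZ; first exact: measurable_cst.
apply: measurable_row_sum => i; apply: measurable_gnoise => //.
exact: (measurableT_comp (measurable_tnth i) mu).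
Qed.

Definition batch (w : Omega) : B.-tuple Xi := [tuple xi i w | i < B].

Lemma measurable_batch : measurable_fun [set: Omega] batch.
Proof.
apply/measurable_fun_tnthP => i.
rewrite (_ : _ \o _ = xi i); first exact: measurable_funPT.
by apply/funext => w /=; rewrite tnth_mktuple.
Qed.

HB.instance Definition _ :=
  isMeasurableFun.Build _ _ _ _ batch measurable_batch.

Lemma batch_noiseE x w :
  batch_noise x (batch w) = kap *: \sum_(i < B) gnoise x (xi i w).
Proof. by congr (_ *: _); apply: eq_bigr => i _; rewrite tnth_mktuple. Qed.

(** Variance proxy of [batch_noise]: B vectors of norm at most r, scaled by [kap]. For the [kap] of
    SGLD it is the a of the overview. *)
Definition noise_size (x : 'rV[R]_d) : R :=
  B%:R * noise_radius x ^+ 2 * kap ^+ 2.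

Lemma noise_size_ge0 x : 0 <= noise_size x.
Proof. by apply: mulr_ge0; [apply: mulr_ge0|]; rewrite ?sqr_ge0. Qed.

Local Notation rho := (distribution P batch).

(** The average over u' at fixed u costs exp (2 a |V|^2), that is, exp (s |S|^2) for the batch sum S
    and s = 2 a kap^2. For this s the condition 16 s B r^2 <= 1 reads 32 a^2 <= 1, and the resulting
    exponent 2 s B r^2 is 4 a^2. *)
Lemma integral_exp_batch_noise x : 32 * noise_size x ^+ 2 <= 1 ->
  (\int[rho]_u \int[rho]_u'
     (expR (dotv (batch_noise x u') (batch_noise x u)))%:E
   <= (expR (4 * noise_size x ^+ 2))%:E)%E.
Proof.
move=> small.
have mb : measurable_fun [set: B.-tuple Xi] (batch_noise x).
  exact: measurable_batch_noise.
apply: (@le_trans _ _ (\int[rho]_u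
   (expR (2 * noise_size x * dotv (batch_noise x u) (batch_noise x u)))%:E)%E).
  apply: ge0_le_integral => //.
  - by move=> u _; apply: integral_ge0 => u' _; rewrite lee_fin expR_ge0.
  - apply: (@measurable_fun_integral_pair R _ _ _ _ _ _ rho
      (fun z => (expR (dotv (batch_noise x z.2) (batch_noise x z.1)))%:E) id) => //.
      apply/measurable_EFinP; apply: measurableT_comp => //.
      by apply: measurable_dotv; exact: measurable_batch_noise.
  - apply/measurable_EFinP; apply: measurableT_comp => //.
    by apply: measurable_funM => //; exact: measurable_dotv.
  - move=> u _.
    rewrite (@ge0_integral_distribution _ _ _ _ _ P batch)/=; last 2 first.
    + apply/measurable_EFinP; apply: measurableT_comp => //.
      by apply: measurable_dotv.
    + by move=> u'; rewrite lee_fin expR_ge0.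
    under eq_integral do rewrite batch_noiseE dotvZl -dotvZr dotvC.
    apply: le_trans (integral_expR_dotv_noise x _) _.
    rewrite lee_fin ler_expR dotvZl dotvZr /noise_size le_eqVlt.
    by apply/orP; left; apply/eqP; ring.
rewrite (@ge0_integral_distribution _ _ _ _ _ P batch)/=; last 2 first.
- apply/measurable_EFinP; apply: measurableT_comp => //.
  by apply: measurable_funM => //; exact: measurable_dotv.
- by move=> u'; rewrite lee_fin expR_ge0.
pose s := 2 * noise_size x * kap ^+ 2.
under eq_integral => w _.
  rewrite batch_noiseE dotvZl dotvZr.
  rewrite [X in expR X](_ : _ = s * dotv (\sum_(i < B) gnoise x (xi i w))
                        (\sum_(i < B) gnoise x (xi i w))); last first.
    by rewrite /s; ring.
  over.
apply: le_trans (integral_expR_sqr_noise _ _) _.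
- apply: mulr_ge0; last exact: sqr_ge0.
  by apply: mulr_ge0 => //; exact: noise_size_ge0.
- apply: le_trans small; rewrite /s {2}/noise_size le_eqVlt.
  by apply/orP; left; apply/eqP; rewrite /noise_size; ring.
- rewrite lee_fin ler_expR le_eqVlt.
  by apply/orP; left; apply/eqP; rewrite /s /noise_size; ring.
Qed.

(** The second moment is read off the exponential one through s y <= exp (s y), at s = 1 / (16 B
    r^2), the largest value that bound admits. *)
Lemma integral_sqr_batch_noise x : 1 < 32 * noise_size x ^+ 2 ->
  (\int[rho]_u (dotv (batch_noise x u) (batch_noise x u))%:E
   <= (32 * noise_size x)%:E)%E.
Proof.
move=> large.
have a0 := noise_size_ge0 x.
pose b := B%:R * noise_radius x ^+ 2.
have b_ge0 : 0 <= b by rewrite /b mulr_ge0 ?sqr_ge0.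
(* The case assumption excludes a = 0, so that [b] can be inverted. *)
have b0 : 0 < b.
  rewrite lt_def b_ge0 andbT; apply/eqP => b0; move: large.
  by rewrite /noise_size -/b b0 mul0r expr0n mulr0 ltr10.
have mb : measurable_fun [set: B.-tuple Xi] (batch_noise x).
  exact: measurable_batch_noise.
rewrite (@ge0_integral_distribution _ _ _ _ _ P batch)/=; last 2 first.
- by apply/measurable_EFinP; exact: measurable_dotv.
- by move=> u'; rewrite lee_fin dotv_ge0.
pose s := (16 * b)^-1.
have s0 : 0 < s by rewrite invr_gt0 mulr_gt0.
have sb : s * b = 1 / 16 by rewrite /s invfM -mulrA mulVf ?gt_eqF//; field.
have sb16 : 16 * (s * b) = 1 by rewrite sb; field.
have mSB : measurable_fun [set: Omega] (fun w => \sum_(i < B) gnoise x (xi i w)).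
  by apply: measurable_row_sum => j; exact: measurable_gnoise.
apply: (@le_trans _ _ (\int[P]_w ((kap ^+ 2 / s) *
    expR (s * dotv (\sum_(i < B) gnoise x (xi i w))
              (\sum_(i < B) gnoise x (xi i w))))%:E)%E).
  apply: ge0_le_integral_EFin => //.
  - apply: measurable_dotv; exact: (measurableT_comp mb measurable_batch).
  - apply: measurable_funM => //; apply: measurableT_comp => //.
    by apply: measurable_funM => //; exact: measurable_dotv.
  - by move=> w; exact: dotv_ge0.
  - move=> w; rewrite batch_noiseE dotvZl dotvZr mulrA -expr2 -mulrA.
    apply: ler_wpM2l; first exact: sqr_ge0.
    rewrite mulrC ler_pdivlMr// mulrC.
    by have := expR_ge1Dx (s * dotv (\sum_(i < B) gnoise x (xi i w))
              (\sum_(i < B) gnoise x (xi i w))); lra.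
rewrite ge0_integralZl_real; last 3 first.
- apply: measurableT_comp => //.
  by apply: measurable_funM => //; exact: measurable_dotv.
- by move=> w; exact: expR_ge0.
- by rewrite divr_ge0 ?sqr_ge0// ltW.
apply: le_trans (lee_wpmul2l _ (integral_expR_sqr_noise _ _)) _.
- by rewrite lee_fin divr_ge0 ?sqr_ge0// ltW.
- exact: ltW.
- by move: sb16; rewrite /b !mulrA => ->.
rewrite -EFinM lee_fin (_ : 2 * s * B%:R * noise_radius x ^+ 2 = 2 * (s * b)); last by rewrite /b !mulrA.
have e2 : expR (2 * (s * b)) <= 2.
  by apply: le_trans (expR_le_quadratic _) _; rewrite sb; lra.
apply: (@le_trans _ _ (kap ^+ 2 / s * 2)).
  by rewrite ler_wpM2l// divr_ge0 ?sqr_ge0// ltW.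
rewrite /s invrK /noise_size -/b le_eqVlt.
by apply/orP; left; apply/eqP; ring.
Qed.

End gradient_noise.

(** * SGLD against LMC *)

Section path_state.
Context {R : realType} {d : nat}.
Variable K : nat.
Local Notation state := ('rV[R]_d * K.-tuple 'rV[R]_d)%type.

(* Carries the path up to time [k], padded with [0], so that the chains live in one
   state space for all [k]. *)
Definition path_state {Omega : Type} (x : nat -> Omega -> 'rV[R]_d) k w : state :=
  (x k w, [tuple if (i < k)%N then x i.+1 w else 0 | i < K]).

Variables (drift : 'rV[R]_d -> 'rV[R]_d) (c : R).

(** Slot [i] holds the iterate of index [i + 1], so the step leaving time [k] fills slot [k]. *)
Definition path_step (k : nat) (z : state * 'rV[R]_d) : state :=
  let y := drift z.1.1 + c *: z.2 in
  (y, [tuple if i == k :> nat then y else tnth z.1.2 i | i < K]).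

Lemma path_stateS {Omega : Type} (x e : nat -> Omega -> 'rV[R]_d) k w :
  x k.+1 w = drift (x k w) + c *: e k w ->
  path_state x k.+1 w = path_step k (path_state x k w, e k w).
Proof.
move=> xS; rewrite /path_step /= -xS /path_state; congr (_, _).
apply: eq_from_tnth => i; rewrite !tnth_mktuple ltnS leq_eqVlt.
by case: eqP => [->|].
Qed.

Lemma measurable_path_step k : measurable_fun [set: 'rV[R]_d] drift ->
  measurable_fun [set: (state * 'rV[R]_d)%type] (path_step k).
Proof.
move=> mdrift.
have my : measurable_fun [set: (state * 'rV[R]_d)%type]
    (fun z => drift z.1.1 + c *: z.2).
  apply: measurable_rowD.
    apply: (measurableT_comp mdrift).
    exact: (measurableT_comp measurable_fst measurable_fst).
  by apply: measurable_rowZ => //; exact: measurable_cst.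
apply: measurable_fun_pair => //; apply/measurable_fun_tnthP => i.
rewrite (_ : _ \o _ = fun z => if i == k :> nat then drift z.1.1 + c *: z.2
  else tnth z.1.2 i); last by apply/funext => z /=; rewrite tnth_mktuple.
case: eqP => // _; apply: (measurableT_comp (measurable_tnth i)).
exact: (measurableT_comp measurable_snd measurable_fst).
Qed.

Lemma adapted_path_state {dO} {Omega : measurableType dO}
    (G : set_system Omega) (x : nat -> Omega -> 'rV[R]_d) k :
  (forall j, (j <= k)%N -> adapted G (x j)) -> adapted G (path_state x k).
Proof.
move=> ax; apply: adapted_pair; first exact: ax.
rewrite (_ : (fun w => _) = (fun w => [tuple (if (i < k)%N then x i.+1 else
  (fun=> 0)) w | i < K])); last first.
  by apply/funext => w; apply: eq_from_tnth => i; rewrite !tnth_mktuple; case: ifP.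
by apply: adapted_tuple => i; case: ifPn => ik; [exact: ax|exact: adapted_cst].
Qed.

Lemma trajectory_path_state {dO} {Omega : measurableType dO}
    {P : probability Omega R} (x : nat -> {RV P >-> 'rV[R]_d}) w :
  trajectory x K w = (path_state x K w).2.
Proof.
by apply: eq_from_tnth => i; rewrite !tnth_mktuple ltn_ord.
Qed.

End path_state.

Lemma integral_eq_law {R : realType} {d d' d''} {Omega : measurableType d}
    {Omega' : measurableType d'} {T : measurableType d''}
    (P : probability Omega R) (P' : probability Omega' R)
    (X : {RV P >-> T}) (X' : {RV P' >-> T}) (phi : T -> \bar R) :
  eq_law (distribution P X) (distribution P' X') ->
  measurable_fun [set: T] phi -> (forall t, (0 <= phi t)%E) ->
  (\int[P']_w phi (X' w) = \int[P]_w phi (X w))%E.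
Proof.
move=> XX' mphi phi0.
transitivity (\int[distribution P' X']_t phi t)%E.
  by rewrite (@ge0_integral_distribution _ _ _ _ _ P' X').
transitivity (\int[distribution P X]_t phi t)%E.
  by apply: eq_measure_integral => A mA _; exact: (esym (XX' A mA)).
by rewrite (@ge0_integral_distribution _ _ _ _ _ P X).
Qed.

Lemma exprD4_le {R : realFieldType} (x y : R) :
  (x + y) ^+ 4 <= 8 * (x ^+ 4 + y ^+ 4).
Proof.
have h (u v : R) : (u + v) ^+ 2 <= 2 * (u ^+ 2 + v ^+ 2).
  by have := sqr_ge0 (u - v); rewrite sqrrB sqrrD; lra.
have -> : (x + y) ^+ 4 = ((x + y) ^+ 2) ^+ 2 by rewrite -exprM.
apply: (@le_trans _ _ ((2 * (x ^+ 2 + y ^+ 2)) ^+ 2)).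
  by rewrite lerXn2r ?nnegrE ?sqr_ge0 ?mulr_ge0 ?addr_ge0 ?sqr_ge0.
by have := h (x ^+ 2) (y ^+ 2); rewrite exprMn -!exprM; lra.
Qed.

(** * The chain comparison for SGLD and LMC *)

Section KL_sgld_lmc.
Context {R : realType} {d : nat} {dispXi} {Xi : measurableType dispXi}.
Variables (F : 'rV[R]_d -> R) (PXi : probability Xi R)
  (f : 'rV[R]_d -> Xi -> R) (eta : R) (B K : nat) (M G : R).
Hypotheses (unb : unbiased_gradient PXi f F) (eta0 : 0 < eta) (B0 : (0 < B)%N)
  (M0 : 0 <= M) (G0 : 0 <= G) (grow : linear_growth f F M G).
Context {disp disp'} {Omega : measurableType disp} {Omega' : measurableType disp'}
  {P : probability Omega R} {P' : probability Omega' R}.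
Variables (x eps : nat -> {RV P >-> 'rV[R]_d})
  (xhat eps' : nat -> {RV P' >-> 'rV[R]_d})
  (xi : nat -> 'I_B -> {RV P' >-> Xi}).

Let E (i : option nat) : set_system Omega :=
  match i with
  | None => sigma_RV (x 0%N)
  | Some k => sigma_RV (eps k)
  end.

Let E' (i : option (nat + nat * 'I_B)) : set_system Omega' :=
  match i with
  | None => sigma_RV (xhat 0%N)
  | Some (inl k) => sigma_RV (eps' k)
  | Some (inr (k, i)) => sigma_RV (xi k i)
  end.

Hypotheses (eps_gauss : forall k, std_gaussian (eps k))
  (eps'_gauss : forall k, std_gaussian (eps' k))
  (xi_law : forall k i, eq_law (distribution P' (xi k i)) PXi)
  (indepE : mutually_independent P E) (indepE' : mutually_independent P' E')
  (xS : forall k w, x k.+1 w =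
    x k w - eta *: grad F (x k w) + Num.sqrt (2 * eta) *: eps k w)
  (xhatS : forall k w, xhat k.+1 w =
    xhat k w - (eta / B%:R) *: (\sum_(i < B) grad (f ^~ (xi k i w)) (xhat k w))
      + Num.sqrt (2 * eta) *: eps' k w)
  (x0_law : eq_law (distribution P (x 0%N)) (distribution P' (xhat 0%N))).

Let drift y := y - eta *: grad F y.
Let c := Num.sqrt (2 * eta).
(** Chosen so that c kap = - eta / B: the batch noise is measured in units of the injected Gaussian
    and adds to it directly. *)
Let kap := - (eta / B%:R) / c.
Let state := ('rV[R]_d * K.-tuple 'rV[R]_d)%type.
Let V (z : state * B.-tuple Xi) := batch_noise f F kap z.1.1 z.2.
Let s k w := path_state K x k w.
Let s' k w := path_state K xhat k w.
(** The laws at time 0 serve as references for all times, the Gaussian one on both probability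
    spaces. *)
Let gam := distribution P' (eps' 0%N).
Let rho := distribution P' (batch (xi 0%N)).
Let a (t : state) := noise_size M G B kap t.1.
Let small t := 32 * a t ^+ 2 <= 1.

Let mdrift : measurable_fun [set: 'rV[R]_d] drift.
Proof.
apply: measurable_rowD => //; apply: measurable_rowN; apply: measurable_rowZ.
  exact: measurable_cst.
exact: measurable_grad unb.
Qed.

Let gamE : gaussian_measure gam.
Proof. exact: std_gaussian_distribution. Qed.

Let mV : measurable_fun [set: (state * B.-tuple Xi)%type] V.
Proof.
apply: (measurable_batch_noise unb) => //.
exact: (measurableT_comp measurable_fst measurable_fst).
Qed.

Let ma : measurable_fun [set: state] a.
Proof.
apply: measurable_funM => //; apply: measurable_funM => //.
apply: measurable_funX; apply: measurable_funD => //.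
apply: measurable_funM => //; exact: measurable_enorm.
Qed.

Let msmall : measurable_fun [set: state] small.
Proof.
apply: measurable_fun_ler => //; apply: measurable_funM => //.
exact: measurable_funX.
Qed.

Let Em i : E i `<=` measurable.
Proof. by case: i => [k|]; exact: sigma_RV_measurable. Qed.
Let ET i : E i setT. Proof. by case: i => [k|]; exact: sigma_RVT. Qed.
Let EI i : setI_closed (E i).
Proof. by case: i => [k|]; exact: sigma_RV_setI. Qed.

Let E'm i : E' i `<=` measurable.
Proof. by case: i => [[k|[k i]]|]; exact: sigma_RV_measurable. Qed.
Let E'T i : E' i setT. Proof. by case: i => [[k|[k i]]|]; exact: sigma_RVT. Qed.
Let E'I i : setI_closed (E' i).
Proof. by case: i => [[k|[k i]]|]; exact: sigma_RV_setI. Qed.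

(** The sources that determine the iterate of index [k]: the initial point and the noise of strictly
    earlier steps. *)
Let past k (i : option nat) := if i is Some j then (j < k)%N else true.

Let past' k (i : option (nat + nat * 'I_B)) :=
  match i with
  | None => true
  | Some (inl j) => (j < k)%N
  | Some (inr (j, _)) => (j < k)%N
  end.

Let adapted_x k j : (k <= j)%N -> adapted (finI_system E (past j)) (x k).
Proof.
elim: k => [_|k IH kj]; first exact: (adapted_sigma_RV (i := None)).
have ax := IH (ltnW kj).
have -> : x k.+1 = (fun w => drift (x k w) + c *: eps k w) :> (_ -> _).
  by apply/funext => w; rewrite xS.
have ae : adapted (finI_system E (past j)) (eps k).
  exact: (adapted_sigma_RV (i := Some k)).
apply: measurable_rowD; first exact: (measurableT_comp mdrift ax).
by apply: measurable_rowZ => //; exact: measurable_cst.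
Qed.

(** The B copies of grad F subtracted inside [gnoise], scaled by eta / B, rebuild the drift of
    LMC. *)
Let noise_step k w : xhat k.+1 w =
  drift (xhat k w) + c *: (batch_noise f F kap (xhat k w) (batch (xi k) w) + eps' k w).
Proof.
have c0 : c != 0 by rewrite gt_eqF// sqrtr_gt0 mulr_gt0.
have Bn0 : B%:R != 0 :> R by rewrite pnatr_eq0 -lt0n.
rewrite xhatS scalerDr addrA; congr (_ + _).
rewrite batch_noiseE scalerA /kap mulrCA mulfV// mulr1.
rewrite /gnoise big_split/= sumrN sumr_const card_ord scalerBr.
rewrite !scaleNr opprK /drift -!addrA; congr (_ + _).
rewrite -(scaler_nat B (grad F _)) scalerA divfK//.
by rewrite addrCA addNr addr0.
Qed.

Let adapted_batch k j : (k < j)%N ->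
  adapted (finI_system E' (past' j)) (batch (xi k)).
Proof.
move=> kj; apply: adapted_tuple => i.
exact: (adapted_sigma_RV (i := Some (inr (k, i)))).
Qed.

Let adapted_eps' k j : (k < j)%N ->
  adapted (finI_system E' (past' j)) (eps' k).
Proof. by move=> kj; exact: (adapted_sigma_RV (i := Some (inl k))). Qed.

Let adapted_xhat k j : (k <= j)%N -> adapted (finI_system E' (past' j)) (xhat k).
Proof.
elim: k => [_|k IH kj]; first exact: (adapted_sigma_RV (i := None)).
have ax := IH (ltnW kj).
have -> : xhat k.+1 = (fun w => drift (xhat k w) +
    c *: (batch_noise f F kap (xhat k w) (batch (xi k) w) + eps' k w)) :> (_ -> _).
  by apply/funext => w; rewrite noise_step.
apply: measurable_rowD; first exact: (measurableT_comp mdrift ax).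
apply: measurable_rowZ; first exact: measurable_cst.
apply: measurable_rowD; last exact: adapted_eps'.
by apply: (measurable_batch_noise unb) => //; exact: adapted_batch.
Qed.

Let adapted_s' k j : (k <= j)%N -> adapted (finI_system E' (past' j)) (s' k).
Proof.
move=> kj; apply: adapted_path_state => i ik.
by apply: adapted_xhat; exact: leq_trans kj.
Qed.

Let batch_xi k w := batch (xi k) w.
Let eps'_fun k w := eps' k w.

Let adapted_weight k : adapted (finI_system E' (past' k))
  (weight rho V small s' eps'_fun batch_xi k).
Proof.
apply: measurable_prod => j _; apply: (measurableT_comp measurable_inv).
have aj := adapted_s' (ltnW (ltn_ord j)).
have an : adapted (finI_system E' (past' k)) (noise V s' batch_xi j).
  apply: (measurableT_comp mV); apply: measurable_fun_pair => //.
  exact: adapted_batch.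
apply: measurable_likelihood => //.
by apply: measurable_rowD => //; exact: adapted_eps'.
Qed.

(** On boxes, mutual independence and [xi_law] give the same product at every time, and boxes
    determine the law. *)
Let batch_law k A : measurable A -> P' (batch (xi k) @^-1` A) = rho A.
Proof.
move=> mA.
have box j (C : 'I_B -> set Xi) : (forall i, measurable (C i)) ->
    P' [set w | forall i, C i (xi j i w)] = (\prod_(i < B) PXi (C i))%E.
  move=> mC.
  pose H (i : option (nat + nat * 'I_B)) : set Omega' :=
    if i is Some (inr (_, i)) then xi j i @^-1` C i else setT.
  have := indepE' (J := [seq Some (inr (j, i)) | i <- enum 'I_B]) (A := H).
  rewrite big_map big_enum/= => HH.
  rewrite (_ : [set w | _] = \bigcap_(i in [set` [seq Some (inr (j, i)) |
      i <- enum 'I_B]]) H i).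
    rewrite HH.
    - by apply: eq_bigr => i _; rewrite -(xi_law j i (mC i)).
    - by rewrite map_inj_uniq ?enum_uniq// => i i' [].
    - by move=> _ /mapP[i _ ->] /=; exists (C i) => //; rewrite setTI.
  apply/seteqP; split=> [w wC i|w wH i].
    by move=> /mapP[i' _ ->]; exact: wC.
  by apply: (wH (Some (inr (j, i)))); apply/mapP; exists i; rewrite ?mem_enum.
have -> : P' (batch (xi k) @^-1` A) = distribution P' (batch (xi k)) A by [].
apply: (@g_sigma_preimage_unique R _ _ _ _ B (fun i (u : B.-tuple Xi) => tnth u i)
  (distribution P' (batch (xi k))) rho _ _ _ mA) => //.
move=> C mC.
have rw j : distribution P' (batch (xi j)) [set w | forall i, C i (tnth w i)] =
    (\prod_(i < B) PXi (C i))%E.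
  rewrite -(box j C mC); congr (P' _).
  by apply/seteqP; split=> w wC i; have := wC i; rewrite /= tnth_mktuple.
by apply: etrans (rw k) (esym (rw 0%N)).
Qed.

Let eps'_law k A : measurable A -> P' (eps' k @^-1` A) = gam A.
Proof.
exact: (gaussian_measure_unique
  (std_gaussian_distribution (eps'_gauss k)) gamE).
Qed.

Let eps_law k A : measurable A -> P (eps k @^-1` A) = gam A.
Proof.
exact: (gaussian_measure_unique
  (std_gaussian_distribution (eps_gauss k)) gamE).
Qed.

Let s_indep k (phi : state * 'rV[R]_d -> \bar R) :
  measurable_fun [set: (state * 'rV[R]_d)%type] phi -> (forall u, (0 <= phi u)%E) ->
  (\int[P]_w phi (s k w, eps k w) = \int[P]_w \int[gam]_e phi (s k w, e))%E.
Proof.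
apply: (ge0_integral_indep_adapted Em ET EI indepE (Q := past k)
  (Q' := pred1 (Some k))).
- by move=> [j|]//= jk; apply/eqP => -[jE]; rewrite jE ltnn in jk.
- by apply: adapted_path_state => j jk; exact: adapted_x.
- by apply: (adapted_sigma_RV (i := Some k)) => /=.
- exact: eps_law.
Qed.

Let s'_indep k (phi : (state * R) * B.-tuple Xi * 'rV[R]_d -> \bar R) :
  measurable_fun [set: ((state * R) * B.-tuple Xi * 'rV[R]_d)%type] phi ->
  (forall u, (0 <= phi u)%E) ->
  (\int[P']_w phi (((s' k w, weight rho V small s' eps'_fun batch_xi k w),
     batch_xi k w), eps'_fun k w) =
   \int[P']_w \int[rho]_u \int[gam]_e
     phi (((s' k w, weight rho V small s' eps'_fun batch_xi k w), u), e))%E.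
Proof.
move=> mphi phi0.
(* The past together with the current batch. The Gaussian is integrated out against it, and
   afterwards the batch against the past alone. *)
pose Q1 (i : option (nat + nat * 'I_B)) :=
  past' k i || (if i is Some (inr (j, _)) then j == k else false).
pose Qxi (i : option (nat + nat * 'I_B)) :=
  if i is Some (inr (j, _)) then j == k else false.
have past_Q1 i : past' k i -> Q1 i by rewrite /Q1 => ->.
have asw : adapted (finI_system E' (past' k))
    (fun w => (s' k w, weight rho V small s' eps'_fun batch_xi k w)).
  by apply: adapted_pair; [exact: adapted_s'|exact: adapted_weight].
have ab (Q : pred (option (nat + nat * 'I_B))) :
    (forall i, Q (Some (inr (k, i)))) -> adapted (finI_system E' Q) (batch (xi k)).
  move=> HQ; apply: adapted_tuple => i.
  exact: (adapted_sigma_RV (i := Some (inr (k, i)))).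
transitivity (\int[P']_w \int[gam]_e phi (((s' k w,
    weight rho V small s' eps'_fun batch_xi k w), batch_xi k w), e))%E.
  apply: (ge0_integral_indep_adapted E'm E'T E'I indepE' (Q := Q1)
    (Q' := pred1 (Some (inl k)))) => //.
  - move=> [[j|[j i]]|]//=; rewrite /Q1/= orbF => jk.
    by apply/eqP => -[jE]; rewrite jE ltnn in jk.
  - apply: adapted_pair; last by apply: ab => i; rewrite /Q1/= eqxx orbT.
    exact: (adaptedS (finI_systemS past_Q1) asw).
  - by apply: (adapted_sigma_RV (i := Some (inl k))) => /=.
  - exact: eps'_law.
apply: (ge0_integral_indep_adapted E'm E'T E'I indepE' (Q := past' k) (Q' := Qxi)
  (nu := rho) (phi := fun z => \int[gam]_e phi (z, e))%E) => //.
- move=> [[j|[j i]]|]//=; rewrite /Qxi => jk.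
  by apply/eqP => jE; rewrite jE ltnn in jk.
- by apply: ab => i; rewrite /Qxi/=.
- exact: batch_law.
- exact: (@measurable_fun_integral_pair R _ _ _ _ _ _ gam phi id).
- by move=> z; apply: integral_ge0.
Qed.

Let sqr_kap : kap ^+ 2 = eta / (2 * B%:R ^+ 2).
Proof.
have Bn0 : B%:R != 0 :> R by rewrite pnatr_eq0 -lt0n.
rewrite /kap exprMn sqrrN exprVn sqr_sqrtr; last by rewrite mulr_ge0// ltW.
by field; rewrite Bn0 gt_eqF.
Qed.

(** With a = eta r^2 / (2 B), 320 a^2 is 80 (eta / B)^2 r^4, and the fourth power of r = M |x| + G
    costs a factor 8: hence 640. *)
Let a_le t : 320 * a t ^+ 2 <=
  640 * (eta ^+ 2 / B%:R ^+ 2) * (M ^+ 4 * enorm t.1 ^+ 4 + G ^+ 4).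
Proof.
have Bn0 : B%:R != 0 :> R by rewrite pnatr_eq0 -lt0n.
have -> : a t = eta * noise_radius M G t.1 ^+ 2 / (2 * B%:R).
  by rewrite /a /noise_size sqr_kap; field.
have -> : 320 * (eta * noise_radius M G t.1 ^+ 2 / (2 * B%:R)) ^+ 2 =
    (80 * (eta ^+ 2 / B%:R ^+ 2)) * noise_radius M G t.1 ^+ 4 by field.
have -> : 640 * (eta ^+ 2 / B%:R ^+ 2) * (M ^+ 4 * enorm t.1 ^+ 4 + G ^+ 4) =
    (80 * (eta ^+ 2 / B%:R ^+ 2)) * (8 * ((M * enorm t.1) ^+ 4 + G ^+ 4)).
  by rewrite exprMn; ring.
apply: ler_wpM2l; first by rewrite mulr_ge0// divr_ge0// sqr_ge0.
exact: exprD4_le.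
Qed.

Variable m4 : R.
Hypothesis moment4 : forall k, (k <= K)%N ->
  (\int[P']_w (enorm (xhat k w) ^+ 4)%:E <= m4%:E)%E.

Lemma KL_sgld_lmc_le :
  (KL (distribution P' (trajectory xhat K)) (distribution P (trajectory x K)) <=
   (K%:R * (640 * (eta ^+ 2 / B%:R ^+ 2) * (M ^+ 4 * m4 + G ^+ 4)))%:E)%E.
Proof.
have idx_inj : injective (fun i : 'I_B => Some (inr (0%N, i)) : option (nat + nat * 'I_B)).
  by move=> i i' [].
have ms k : measurable_fun [set: Omega] (s k).
  apply: (adapted_measurable (G := finI_system E (past k))).
    exact: sigma_finI_measurable.
  by apply: adapted_path_state => j jk; exact: (adapted_x jk).
have ms' k : measurable_fun [set: Omega'] (s' k).
  apply: (adapted_measurable (G := finI_system E' (past' k))).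
    exact: sigma_finI_measurable.
  exact: adapted_s'.
have sS k w : s k.+1 w = path_step drift c k (s k w, eps k w).
  exact: (@path_stateS R d K drift c Omega (fun k w => x k w)
    (fun k w => eps k w) k w (xS k w)).
have s'S k w : s' k.+1 w =
    path_step drift c k (s' k w, noise V s' batch_xi k w + eps'_fun k w).
  exact: (@path_stateS R d K drift c Omega' (fun k w => xhat k w)
    (fun k w => noise V s' batch_xi k w + eps'_fun k w) k w (noise_step k w)).
(* At time 0 the path component is pure padding, so equality of the initial laws suffices. *)
have s0_law (phi : state -> \bar R) : measurable_fun [set: state] phi ->
    (forall t, (0 <= phi t)%E) ->
    (\int[P']_w phi (s' 0%N w) = \int[P]_w phi (s 0%N w))%E.
  move=> mphi phi0; pose psi y := phi (y, [tuple 0 | i < K]).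
  apply: (integral_eq_law (phi := psi) x0_law); last by move=> y; exact: phi0.
  by apply: (measurableT_comp mphi); exact: measurable_fun_pair.
have exp_noise t : small t ->
    (\int[rho]_u \int[rho]_u' (expR (dotv (V (t, u')) (V (t, u))))%:E
     <= (expR (4 * a t ^+ 2))%:E)%E.
  exact: (integral_exp_batch_noise unb M0 G0 grow E'm E'T E'I indepE'
    B0 idx_inj (fun i => erefl) (xi_law 0%N)).
have sqr_noise t : ~~ small t ->
    (\int[rho]_u (dotv (V (t, u)) (V (t, u)))%:E <= (32 * a t)%:E)%E.
  rewrite -ltNge; exact: (integral_sqr_batch_noise unb M0 G0 grow
    E'm E'T E'I indepE' B0 idx_inj (fun i => erefl) (xi_law 0%N)).
have mbatch k : measurable_fun [set: Omega'] (batch_xi k).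
  exact: measurable_batch.
have meps' k : measurable_fun [set: Omega'] (eps'_fun k) by [].
apply: (KL_chain_le gamE mV msmall (fun k => measurable_path_step c k mdrift) sS
  s_indep ms' meps' mbatch s'S s'_indep s0_law ma (fun t => noise_size_ge0 _ _ _ _ _)
  (fun t => erefl) exp_noise sqr_noise measurable_snd
  (trajectory_path_state K x) (trajectory_path_state K xhat)).
move=> k kK.
have C0 : 0 <= 640 * (eta ^+ 2 / B%:R ^+ 2).
  apply: mulr_ge0; first exact: ler0n.
  by apply: divr_ge0; apply: sqr_ge0.
have mx4 : measurable_fun [set: Omega'] (fun w => enorm (xhat k w) ^+ 4).
  by apply: measurable_funX; exact: measurable_enorm.
apply: (@le_trans _ _ (\int[P']_w ((640 * (eta ^+ 2 / B%:R ^+ 2)) *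
    (M ^+ 4 * enorm (xhat k w) ^+ 4 + G ^+ 4))%:E)%E).
  apply: ge0_le_integral_EFin.
  - by apply: measurable_funM => //; apply: measurable_funX; exact: (measurableT_comp ma).
  - by apply: measurable_funM => //; apply: measurable_funD => //; exact: measurable_funM.
  - by move=> w; apply: mulr_ge0; [exact: ler0n|exact: sqr_ge0].
  - by move=> w; exact: a_le.
rewrite ge0_integralZl_real//; last 2 first.
- by apply: measurable_funD => //; exact: measurable_funM.
- by move=> w; rewrite addr_ge0// ?mulr_ge0// ?exprn_ge0// enorm_ge0.
rewrite [leRHS]EFinM; apply: lee_wpmul2l; first by rewrite lee_fin.
under eq_integral do rewrite EFinD.
rewrite ge0_integralD//=; last 3 first.
- by move=> w _; rewrite lee_fin mulr_ge0// exprn_ge0// enorm_ge0.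
- by apply/measurable_EFinP; exact: measurable_funM.
- by move=> w _; rewrite lee_fin exprn_ge0.
rewrite integral_probability_cst [leRHS]EFinD leeD2r// ge0_integralZl_real//; last 2 first.
- by move=> w; rewrite exprn_ge0// enorm_ge0.
- by rewrite exprn_ge0.
rewrite [leRHS]EFinM; apply: lee_wpmul2l; first by rewrite lee_fin exprn_ge0.
exact: moment4 (ltnW kK).
Qed.

End KL_sgld_lmc.

Theorem theorem8 (R : realType) :
  exists2 c : R, 0 < c &
  forall (d : nat) (F : 'rV[R]_d -> R)
    (dispXi : measure_display) (Xi : measurableType dispXi)
    (PXi : probability Xi R) (f : 'rV[R]_d -> Xi -> R)
    (eta : R) (B K : nat) (M G : R) (C : R -> R)
    (disp : measure_display) (Omega : measurableType disp)
    (P : probability Omega R) (x : nat -> {RV P >-> 'rV[R]_d})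
    (disp' : measure_display) (Omega' : measurableType disp')
    (P' : probability Omega' R) (xhat : nat -> {RV P' >-> 'rV[R]_d}),
  (forall y, differentiable F y) ->
  unbiased_gradient PXi f F ->
  0 < eta -> (1 <= B)%N -> 0 <= M -> 0 <= G ->
  linear_growth f F M G ->
  LMC F eta x ->
  SGLD PXi f eta B xhat ->
  eq_law (distribution P (x 0%N)) (distribution P' (xhat 0%N)) ->
  moment_growth xhat K 6 C ->
  (KL (distribution P' (trajectory xhat K)) (distribution P (trajectory x K))
   <= (c * (eta ^+ 2 * K%:R / B%:R ^+ 2
              * (M ^+ 4 * C 4 * d%:R ^+ 2 + G ^+ 4)
            + eta ^+ 3 * K%:R / B%:R ^+ 4
              * (M ^+ 6 * C 6 * d%:R ^+ 6 + G ^+ 6 * d%:R ^+ 3)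
              * (1 + ln B%:R) ^+ 2))%:E)%E.
Proof.
exists 640; first by rewrite ltr0n.
move=> d F dispXi Xi PXi f eta B K M G C disp Omega P x disp' Omega' P' xhat.
move=> _ unb eta0 B0 M0 G0 grow [eps [eps_gauss indep xS]].
move=> [eps' [xi [eps'_gauss xi_law indep' xhatS]]] x0_law [C0 _ Cmom].
have moment4 k : (k <= K)%N ->
    (\int[P']_w (enorm (xhat k w) ^+ 4)%:E <= (C 4 * d%:R ^+ 2)%:E)%E.
  move=> kK; have p4 : 0 <= (4 : R) <= 6 by apply/andP; split; lra.
  have := Cmom 4 k p4 kK; rewrite unlock.
  rewrite (_ : 4 / 2 = 2%:R :> R); last by field.
  rewrite powR_mulrn ?ler0n//.
  by under eq_integral do rewrite (powR_mulrn 4) ?enorm_ge0//.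
apply: le_trans (KL_sgld_lmc_le unb eta0 B0 M0 G0 grow eps_gauss eps'_gauss
  xi_law indep indep' xS xhatS x0_law moment4) _.
rewrite lee_fin.
have p6 : 0 <= (6 : R) <= 6 by apply/andP; split; lra.
have C60 := C0 6 p6.
(* The bound obtained equals the first term; the second one has to be non-negative, which rests on
   [C 6] being so. *)
rewrite [leRHS]mulrDr -[leLHS]addr0; apply: lerD.
  rewrite le_eqVlt; apply/orP; left; apply/eqP.
  by field; rewrite pnatr_eq0 -lt0n.
apply: mulr_ge0; first exact: ler0n.
apply: mulr_ge0; last exact: sqr_ge0.
apply: mulr_ge0.
  by rewrite divr_ge0 ?exprn_ge0// mulr_ge0 ?exprn_ge0// ltW.
by rewrite addr_ge0 ?mulr_ge0 ?exprn_ge0.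
Qed.
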